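(* Let $M=(M^{2m+1};\varphi,\xi,\eta,g)$ and $N=(N^{2n+1};\phi,\gamma,\sigma,h)$ be almost contact metric manifolds and let $f:M\to N$ be a $(\pm)$-holomorphic map. Suppose that $M$ is non-semi-$\varphi$-involutive (or non-$\varphi$-involutive), is semi-symplectic and satisfies $\nabla_\xi\xi=0$, and that $N$ is quasi-symplectic and satisfies $\nabla_\gamma\gamma=0$. Then $f$ is harmonic.
   Context: Manifolds and maps are smooth; $\nabla$ denotes Levi-Civita connections. An almost contact metric manifold $M=(M^{2m+1};\varphi,\xi,\eta,g)$ is a $(2m+1)$-dimensional Riemannian manifold with a $(1,1)$-tensor $\varphi$, a vector field $\xi$ and a 1-form $\eta$ such that $\varphi^2X=-X+\eta(X)\xi$, $\eta(\xi)=1$, $g(\varphi X,\varphi Y)=g(X,Y)-\eta(X)\eta(Y)$. Put $D^M=\varphi(TM)=\ker\eta$ and $S^M(X,Y)=(\nabla_X\varphi)Y-(\nabla_Y\varphi)X$. $M$ is quasi-symplectic if $S^M(\varphi X,X)=0$ for all $X\in\Gamma(D^M)$; semi-symplectic if $\sum_{i=1}^mS^M(\varphi e_i,e_i)=0$ for local orthonormal frame fields $\{e_1,\dots,e_m;\varphi e_1,\dots,\varphi e_m\}$ of $D^M$; non-$\varphi$-involutive if for every $p\in M$, $[X,\varphi X]_p\notin D^M_p$ for all $X\in\Gamma(D^M)$ with $X_p\neq0$; non-semi-$\varphi$-involutive if for every $p\in M$, $\sum_{i=1}^m[e_i,\varphi e_i]_p\notin D^M_p$ for every local orthonormal frame field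 $\{e_i;\varphi e_i\}$ of $D^M$ near $p$. The same notions apply to $N$ with $(\varphi,\xi,\eta,g,m)$ replaced by $(\phi,\gamma,\sigma,h,n)$. $f$ is $(\pm)$-holomorphic if $f_*\circ\varphi=\phi\circ f_*$ or $f_*\circ\varphi=-\phi\circ f_*$. $f$ is harmonic if its tension field (the trace of its second fundamental form) vanishes.
   Formalization: It is assumed that m ≥ 1: for m = 0 non-φ-involutivity is vacuous and the claim fails, e.g. for M = N = ℝ and f(t) = t². *)

(* Defs.v *)
From HB Require Import structures.
From mathcomp Require Import all_boot all_order all_algebra.
From mathcomp Require Import all_classical all_reals all_analysis.
Import Order.TTheory GRing.Theory Num.Theory.
Import numFieldNormedType.Exports.

Set Implicit Arguments.
Unset Strict Implicit.
Unset Printing Implicit Defensive.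

Local Open Scope classical_set_scope.
Local Open Scope ring_scope.

(* Smooth manifolds are topological spaces with a smooth atlas; tensor fields
   are families of components, one for each chart, related on overlaps by the
   tensor transformation law.  Components are functions of the point of the
   manifold (not of its coordinates), and they only matter on the domain of
   the chart; similarly charts and their inverses are total functions which
   only matter on their domains.  Tangent vectors are row vectors, so that an
   endomorphism acts by multiplication on the right. *)

Section Smooth.
Context {R : realType} {d : nat} {W : normedModType R}.

(* Meant for open sets [A] only. *)
Fixpoint Ck_on (k : nat) (A : set 'rV[R]_d) (F : 'rV[R]_d -> W) : Prop :=
  (forall x, A x -> {for x, continuous F}) /\
  match k with
  | 0 => True
  | k'.+1 => (forall v x, A x -> derivable F x v) /\
             (forall v, Ck_on k' A ('D_v F))
  end.

Definition smooth_on (A : set 'rV[R]_d) (F : 'rV[R]_d -> W) : Prop :=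
  forall k, Ck_on k A F.

End Smooth.

Record manifold (R : realType) (d : nat) := Manifold {
  carrier :> topologicalType;
  chart : Type;
  cdom : chart -> set carrier;
  cmap : chart -> carrier -> 'rV[R]_d;
  cinv : chart -> 'rV[R]_d -> carrier;
  manifold_hausdorff : hausdorff_space carrier;
  manifold_second_countable : @second_countable carrier;
  cdom_cover : forall p, exists i, cdom i p;
  cdom_open : forall i, open (cdom i);
  cmap_open : forall i, open (cmap i @` cdom i);
  cmapK : forall i p, cdom i p -> cinv i (cmap i p) = p;
  cmap_continuous :
    forall i p, cdom i p -> {for p, continuous (cmap i)};
  cinv_continuous :
    forall i x, (cmap i @` cdom i) x -> {for x, continuous (cinv i)};
  transition_smooth : forall i j,
    smooth_on (cmap i @` (cdom i `&` cdom j)) (cmap j \o cinv i) }.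

Section Fields.
Context {R : realType} {d : nat} {M : manifold R d}.
Implicit Types (i j : chart M) (p : M) (U : set M) (u v w : 'rV[R]_d).

(* [F] is smooth on the open set [cdom i `&` U]. *)
Definition csmooth {W : normedModType R} U i (F : M -> W) : Prop :=
  smooth_on (cmap i @` (cdom i `&` U)) (F \o cinv i).

(* Derivative of [F] at [p] along the tangent vector with components [v] in
   the chart [i]. *)
Definition cderiv {W : normedModType R} i (F : M -> W) p v : W :=
  'D_v (F \o cinv i) (cmap i p).

(* Change of components of tangent vectors at [p] from chart [i] to [j]. *)
Definition change i j p v : 'rV[R]_d := cderiv i (cmap j) p v.

Definition vfamily : Type := chart M -> M -> 'rV[R]_d.

Definition vfield_on U (X : vfamily) : Prop :=
  (forall i, csmooth U i (X i)) /\
  (forall i j p, U p -> cdom i p -> cdom j p -> X j p = change i j p (X i p)).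

Definition endo_field (phi : chart M -> M -> 'M[R]_d) : Prop :=
  (forall i, csmooth setT i (phi i)) /\
  (forall i j p v, cdom i p -> cdom j p ->
     change i j p v *m phi j p = change i j p (v *m phi i p)).

Definition pairing (v : 'rV[R]_d) (a : 'cV[R]_d) : R := (v *m a) 0 0.

Definition covector_field (eta : chart M -> M -> 'cV[R]_d) : Prop :=
  (forall i, csmooth setT i (eta i)) /\
  (forall i j p v, cdom i p -> cdom j p ->
     pairing (change i j p v) (eta j p) = pairing v (eta i p)).

Definition inner (G : 'M[R]_d) u v : R := (u *m G *m v^T) 0 0.

Definition riemannian_metric (g : chart M -> M -> 'M[R]_d) : Prop :=
  [/\ forall i, csmooth setT i (g i),
      forall i j p u v, cdom i p -> cdom j p ->
        inner (g j p) (change i j p u) (change i j p v) = inner (g i p) u v,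
      forall i p, cdom i p -> (g i p)^T = g i p &
      forall i p v, cdom i p -> v != 0 -> 0 < inner (g i p) v v].

(* The bracket, the connection and the tensors built from them are computed in
   a chart [i], on the components in [i] of the vector fields. *)
Definition bracket i (X Y : M -> 'rV[R]_d) p : 'rV[R]_d :=
  cderiv i Y p (X p) - cderiv i X p (Y p).

Section LeviCivita.
Variable g : chart M -> M -> 'M[R]_d.

Definition dmetric i p (a b c : 'I_d) : R :=
  cderiv i (fun q => g i q b c) p (delta_mx 0 a).

(* The symbol Gamma_ab^c. *)
Definition christoffel i p (a b c : 'I_d) : R :=
  2^-1 * \sum_l invmx (g i p) c l *
    (dmetric i p a b l + dmetric i p b a l - dmetric i p l a b).

Definition Gamma i p u v : 'rV[R]_d :=
  \row_c \sum_a \sum_b u 0 a * v 0 b * christoffel i p a b c.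

Definition nabla i (X Y : M -> 'rV[R]_d) p : 'rV[R]_d :=
  cderiv i Y p (X p) + Gamma i p (X p) (Y p).

Definition nabla_endo i (X : M -> 'rV[R]_d) (phi : M -> 'M[R]_d)
    (Y : M -> 'rV[R]_d) p : 'rV[R]_d :=
  nabla i X (fun q => Y q *m phi q) p - nabla i X Y p *m phi p.

End LeviCivita.

End Fields.

Arguments vfamily {R d} M.

Section LeviCivitaFacts.
Context {R : realType} {d : nat} {M : manifold R d}.
Variables (g : chart M -> M -> 'M[R]_d) (hg : riemannian_metric g).
Variables (i : chart M) (p : M) (hp : cdom i p).

Let dmetricC a b c : dmetric g i p a b c = dmetric g i p a c b.
Proof.
have [_ _ sym _] := hg.
rewrite /dmetric /cderiv; apply: near_eq_derive.
near=> x.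
have [q hq <-] : (cmap i @` cdom i) x.
  by near: x; apply: open_nbhs_nbhs; split; [exact: cmap_open|exists p].
by rewrite /= (cmapK hq) -[in LHS](sym _ _ hq) mxE.
Unshelve. all: by end_near. Qed.

Lemma metric_unitmx : g i p \in unitmx.
Proof.
have [_ _ _ pos] := hg.
rewrite -row_free_unit -kermx_eq0; apply/eqP/row_matrixP => k; rewrite row0.
apply: contrapT => /eqP nz; have := pos _ _ _ hp nz.
have /sub_kermxP k0 : (row k (kermx (g i p)) <= kermx (g i p))%MS.
  exact: row_sub.
by rewrite /inner k0 mul0mx mxE ltxx.
Qed.

(* The two properties which characterize the Levi-Civita connection. *)
Lemma nabla_torsion_free X Y :
  nabla g i X Y p - nabla g i Y X p = bracket i X Y p.
Proof.
have -> : nabla g i X Y p = cderiv i Y p (X p) + Gamma g i p (Y p) (X p).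
  congr (_ + _); apply/rowP => c; rewrite !mxE exchange_big /=.
  apply: eq_bigr => a _; apply: eq_bigr => b _; rewrite [X p _ _ * _]mulrC.
  congr (_ * _); rewrite /christoffel; congr (_ * _); apply: eq_bigr => l _.
  by rewrite [dmetric g i p l _ _]dmetricC [X in X - _]addrC.
by rewrite /nabla /bracket opprD addrACA subrr addr0.
Qed.

Lemma nabla_metric a b c :
  dmetric g i p a b c = \sum_l christoffel g i p a b l * g i p l c +
                        \sum_l christoffel g i p a c l * g i p l b.
Proof.
have [_ _ sym _] := hg.
have low b' c' : \sum_l christoffel g i p a b' l * g i p l c' =
    2^-1 * (dmetric g i p a b' c' + dmetric g i p b' a c' - dmetric g i p c' a b').
  transitivity (2^-1 * \sum_k (dmetric g i p a b' k + dmetric g i p b' a k -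
      dmetric g i p k a b') * (invmx (g i p) *m g i p) k c').
    rewrite /christoffel; under eq_bigr do rewrite -mulrA mulr_suml.
    rewrite -mulr_sumr exchange_big /=; congr (_ * _); apply: eq_bigr => k _.
    rewrite mxE mulr_sumr; apply: eq_bigr => l _.
    have -> : invmx (g i p) l k = invmx (g i p) k l.
      by rewrite -[in LHS](sym _ _ hp) -trmx_inv mxE.
    by rewrite mulrCA mulrA.
  congr (_ * _); rewrite (mulVmx metric_unitmx) (bigD1 c') //= mxE eqxx mulr1.
  by rewrite big1 ?addr0 // => k /negbTE nk; rewrite mxE nk mulr0.
rewrite !low -mulrDr [dmetric g i p a c b]dmetricC.
rewrite [X in _ * X](_ : _ = 2 * dmetric g i p a b c) ?mulrA ?mulVf ?mul1r //.
set x := dmetric _ _ _ a b c; set y := dmetric _ _ _ b a c.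
set z := dmetric _ _ _ c a b; rewrite -[x + y - z]addrA -[x + z - y]addrA.
by rewrite addrACA -[z - y]opprB subrr addr0 mulr_natl mulr2n.
Qed.

End LeviCivitaFacts.

Section Maps.
Context {R : realType} {d e : nat} {M : manifold R d} {N : manifold R e}.
Variable f : M -> N.

Definition smooth_map : Prop :=
  continuous f /\
  (forall (i : chart M) (b : chart N),
     csmooth (f @^-1` cdom b) i (cmap b \o f)).

(* Components in the chart [b] of the image by f_* of the tangent vector with
   components [v] in the chart [i]. *)
Definition tangent_map (i : chart M) (b : chart N) (p : M) (v : 'rV[R]_d) :
    'rV[R]_e :=
  cderiv i (cmap b \o f) p v.

Variables (g : chart M -> M -> 'M[R]_d) (h : chart N -> N -> 'M[R]_e).

(* The connection induced by that of N on the sections V of f^*TN. *)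
Definition nabla_along (i : chart M) (b : chart N) (X : M -> 'rV[R]_d)
    (V : M -> 'rV[R]_e) (p : M) : 'rV[R]_e :=
  cderiv i V p (X p) + Gamma h b (f p) (tangent_map i b p (X p)) (V p).

Definition second_fundamental_form (i : chart M) (b : chart N)
    (X Y : M -> 'rV[R]_d) (p : M) : 'rV[R]_e :=
  nabla_along i b X (fun q => tangent_map i b q (Y q)) p -
  tangent_map i b p (nabla g i X Y p).

Definition tension (i : chart M) (b : chart N) (p : M) : 'rV[R]_e :=
  \sum_(k < d) \sum_(l < d) invmx (g i p) k l *:
    second_fundamental_form i b (cst (delta_mx 0 k)) (cst (delta_mx 0 l)) p.

Definition harmonic_map : Prop :=
  forall i b p, cdom i p -> cdom b (f p) -> tension i b p = 0.

End Maps.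

Record acm_structure (R : realType) (m : nat) (M : manifold R m.*2.+1) :=
  AcmStructure {
  acm_phi : chart M -> M -> 'M[R]_(m.*2.+1);
  acm_xi : vfamily M;
  acm_eta : chart M -> M -> 'cV[R]_(m.*2.+1);
  acm_g : chart M -> M -> 'M[R]_(m.*2.+1);
  acm_phi_field : endo_field acm_phi;
  acm_xi_field : vfield_on setT acm_xi;
  acm_eta_field : covector_field acm_eta;
  acm_g_metric : riemannian_metric acm_g;
  acm_phi_sq : forall i p v, cdom i p ->
    v *m acm_phi i p *m acm_phi i p =
      - v + pairing v (acm_eta i p) *: acm_xi i p;
  acm_eta_xi : forall i p, cdom i p -> pairing (acm_xi i p) (acm_eta i p) = 1;
  acm_compatible : forall i p u v, cdom i p ->
    inner (acm_g i p) (u *m acm_phi i p) (v *m acm_phi i p) =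
      inner (acm_g i p) u v - pairing u (acm_eta i p) * pairing v (acm_eta i p) }.

Section AlmostContactMetric.
Context {R : realType} {m : nat} {M : manifold R m.*2.+1}.
Variable A : acm_structure M.

Local Notation phi := (acm_phi A).
Local Notation xi := (acm_xi A).
Local Notation eta := (acm_eta A).
Local Notation g := (acm_g A).

Definition in_D (i : chart M) (p : M) (v : 'rV[R]_(m.*2.+1)) : Prop :=
  pairing v (eta i p) = 0.

Definition D_section_on (U : set M) (X : vfamily M) : Prop :=
  vfield_on U X /\ (forall i p, U p -> cdom i p -> in_D i p (X i p)).

Definition phi_vf (X : vfamily M) : vfamily M := fun i p => X i p *m phi i p.

Definition S_tensor (i : chart M) (X Y : M -> 'rV[R]_(m.*2.+1)) (p : M) :
    'rV[R]_(m.*2.+1) :=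
  nabla_endo g i X (phi i) Y p - nabla_endo g i Y (phi i) X p.

(* The frame consists of the e_k and the phi e_k; since D has rank 2m,
   orthonormality makes it a basis of D at each point. *)
Definition phi_frame_on (U : set M) (e : 'I_m -> vfamily M) : Prop :=
  (forall k, D_section_on U (e k)) /\
  (forall i p, U p -> cdom i p -> forall k l,
    [/\ inner (g i p) (e k i p) (e l i p) = (k == l)%:R,
        inner (g i p) (e k i p) (phi_vf (e l) i p) = 0 &
        inner (g i p) (phi_vf (e k) i p) (phi_vf (e l) i p) = (k == l)%:R]).

Definition quasi_symplectic : Prop :=
  forall X, D_section_on setT X ->
  forall i p, cdom i p -> S_tensor i (phi_vf X i) (X i) p = 0.

Definition semi_symplectic : Prop :=
  forall (U : set M) e, open U -> phi_frame_on U e ->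
  forall i p, U p -> cdom i p ->
    \sum_(k < m) S_tensor i (phi_vf (e k) i) (e k i) p = 0.

Definition non_phi_involutive : Prop :=
  forall p X, D_section_on setT X ->
  forall i, cdom i p -> X i p != 0 ->
    ~ in_D i p (bracket i (X i) (phi_vf X i) p).

Definition non_semi_phi_involutive : Prop :=
  forall p (U : set M) e, open U -> U p -> phi_frame_on U e ->
  forall i, cdom i p ->
    ~ in_D i p (\sum_(k < m) bracket i (e k i) (phi_vf (e k) i) p).

Definition geodesic_xi : Prop :=
  forall i p, cdom i p -> nabla g i (xi i) (xi i) p = 0.

End AlmostContactMetric.

Section Holomorphic.
Context {R : realType} {m n : nat}.
Context {M : manifold R m.*2.+1} {N : manifold R n.*2.+1}.

(* [c] is the sign, 1 or -1. *)
Definition sign_holomorphic (A : acm_structure M) (B : acm_structure N) (c : R)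
    (f : M -> N) : Prop :=
  forall i b p v, cdom i p -> cdom b (f p) ->
    tangent_map f i b p (v *m acm_phi A i p) =
      c *: (tangent_map f i b p v *m acm_phi B b (f p)).

Definition pm_holomorphic (A : acm_structure M) (B : acm_structure N)
    (f : M -> N) : Prop :=
  sign_holomorphic A B 1 f \/ sign_holomorphic A B (-1) f.

End Holomorphic.

(* Main.v *)
(* Write [sff] for the second fundamental form of [f], [sigma] and [gamma] for the
   1-form and the vector field of [N], and [c] for the sign.  Differentiating
   [f_* (phi v) = c phi' (f_* v)] expresses [sff u (phi v)] through
   [c phi' (sff u v)], [nabla phi] and [nabla phi'].  As [sff] is symmetric, for
   [u] in [D] this gives
     [sff u u + sff (phi u) (phi u) = S^N (phi' V) V - f_* (S^M (phi u) u)]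
   with [V = f_* u]; the two symplectic conditions cancel the trace of [sff] on
   [D].  Moreover [f_* D] lies in the kernel of [sigma] and
   [f_* xi = lam gamma], whence [sff xi xi = (xi lam) gamma].  Since [d sigma]
   and [d eta] are killed by [gamma] and [xi] (this is what the two geodesic
   conditions mean), differentiating [f^* sigma = lam eta] yields
   [d lam = (xi lam) eta]; differentiating once more, [(xi lam) d eta] vanishes
   on [D], so that [xi lam = 0] by non-involutivity. *)

(* [smooth_on] only provides iterated directional derivatives that exist and are continuous;
   linearity in the direction, the chain rule and the symmetry of second derivatives are all drawn
   from the mean value theorem. The geometric hypotheses come in two kinds that need different
   tools. [quasi_symplectic] and [non_phi_involutive] speak of global sections of [D], so using them
   at one point means extending a vector of [D] to the whole manifold: a flat function gives the
   cut-off, and [- phi^2] projects onto [D]. [semi_symplectic] and [non_semi_phi_involutive] speak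
   of local frames, which a smooth Gram-Schmidt process produces near any point. After that, only
   pointwise identities in a pair of charts remain. The condition [0 < m] is there because for
   [m = 0] non-phi-involutivity is vacuous: any smooth map of the line to itself is then
   holomorphic, but it is harmonic only if it is affine. *)
From HB Require Import structures.
Require Import Defs.
From mathcomp Require Import all_boot all_order all_algebra.
From mathcomp Require Import all_classical all_reals all_analysis.
From mathcomp Require Import ring lra zify.
Import Order.TTheory GRing.Theory Num.Theory.
Import numFieldNormedType.Exports.
Set Implicit Arguments.
Unset Strict Implicit.
Unset Printing Implicit Defensive.
Local Open Scope classical_set_scope.
Local Open Scope ring_scope.

(** * Directional derivatives *)

Section DirectionalDerivative.
Context {R : realType} {V : normedModType R}.
Implicit Types (F : V -> R) (x u v w : V).

(** The two quotients are equal as functions, so existence and value of the limit pass together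
    between [F] in direction [v] and its restriction to a line, where one-variable theorems
    apply. *)
Lemma difference_quotient_line F x v (s : R) :
  (fun h : R => h^-1 *: ((F \o shift (x + s *: v)) (h *: v) -
     F (x + s *: v))) =
  (fun h : R => h^-1 *: (((fun t : R => F (x + t *: v)) \o shift s) (h *: 1) -
     F (x + s *: v))).
Proof.
apply/funext => h /=; congr (_ *: (F _ - _)).
by rewrite [h *: 1]mulr1 scalerDl addrCA addrA addrC addrA.
Qed.

Lemma is_derive_line F x v (s : R) : derivable F (x + s *: v) v ->
  is_derive s 1 (fun t : R => F (x + t *: v)) ('D_v F (x + s *: v)).
Proof.
move=> dF; split; first by rewrite /derivable -difference_quotient_line.
by rewrite /derive -difference_quotient_line.
Qed.

Lemma is_derive_of_line F x v (a : R) :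
  is_derive (0 : R) 1 (fun t : R => F (x + t *: v)) a -> is_derive x v F a.
Proof.
move=> [dF <-]; have := difference_quotient_line F x v 0.
rewrite scale0r addr0 => e; split; last by rewrite /derive e scale0r addr0.
by move: dF; rewrite /derivable e scale0r addr0.
Qed.

(** Homogeneity needs no continuity: it is the one-variable chain rule for [t |-> a * t] at [0],
    which also covers [a = 0]. *)
Lemma is_derive_dirZ F x v (a : R) : derivable F x v ->
  is_derive x (a *: v) F (a * 'D_v F x).
Proof.
move=> dF; apply: is_derive_of_line.
have dF0 : is_derive (0 : R) 1 (fun t : R => F (x + t *: v)) ('D_v F x).
  have := @is_derive_line F x v 0; rewrite scale0r addr0; exact.
have := @is_derive1_comp _ (fun t : R => F (x + t *: v)) (fun t : R => a * t) 0
  ('D_v F x) a.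
rewrite mulr0 mulrC => /(_ dF0); rewrite (_ : _ \o _ =
    fun t : R => F (x + t *: (a *: v))); last first.
  by apply/funext => t /=; rewrite scalerA mulrC.
by apply; apply: is_derive_eq; rewrite [LHS]mulr1.
Qed.

Lemma mvt_line F x w :
  (forall s : R, 0 <= s <= 1 -> derivable F (x + s *: w) w) ->
  exists2 s : R, 0 <= s <= 1 & F (x + w) - F x = 'D_w F (x + s *: w).
Proof.
move=> dF; have der (s : R) : 0 <= s <= 1 -> is_derive s 1
    (fun t : R => F (x + t *: w)) ('D_w F (x + s *: w)).
  by move=> s01; apply: is_derive_line; apply: dF.
have [||s s01] := @MVT_segment R (fun t => F (x + t *: w))
  (fun t => 'D_w F (x + t *: w)) 0 1 ler01.
- by move=> s; rewrite in_itv /= => /andP[/ltW s0 /ltW s1]; apply: der; rewrite s0.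
- apply: derivable_within_continuous => s; rewrite in_itv /= => s01.
  by have [] := der _ s01.
rewrite scale1r scale0r addr0 subr0 mulr1 => e; exists s => //.
Qed.

Lemma ball_segment x w (e s : R) : `|w| < e -> 0 <= s <= 1 ->
  ball x e (x + s *: w).
Proof.
move=> we /andP[s0 s1]; rewrite -ball_normE /= opprD addrA subrr sub0r normrN.
rewrite normrZ ger0_norm //; apply: le_lt_trans we.
by rewrite ler_piMl.
Qed.

End DirectionalDerivative.

(** * Functions of class C^1 at a point *)

Section C1Functions.
Context {R : realType} {V : normedModType R}.
Implicit Types (F : V -> R) (x u v w : V).

(** Derivatives exist near [x] but need be continuous at [x] only; nothing is assumed about how they
    depend on the direction. *)
Definition C1_at F x :=
  (\forall y \near x, forall v, derivable F y v) /\
  (forall v, {for x, continuous ('D_v F)}).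

(* Mean value theorem on the segment from [a t] to [a t + h t *: v]. *)
Lemma C1_increment F x v (T : Type) (G : set_system T) {FG : Filter G}
  (a : T -> V) (h : T -> R) : C1_at F x ->
  a t @[t --> G] --> x -> h t @[t --> G] --> 0 -> (\forall t \near G, h t != 0) ->
  (h t)^-1 * (F (a t + h t *: v) - F (a t)) @[t --> G] --> 'D_v F x.
Proof.
move=> [dF cF] ax h0 hn0; apply/cvgrPdist_lt => e e0.
have /cvgrPdist_lt/(_ e e0) := cF v; rewrite near_simpl => cFe.
have [d /= d0 Hd] := (nbhs_ballP _ _).1 (filterI dF cFe).
have d2 : 0 < d / 2 by rewrite divr_gt0.
have ad : \forall t \near G, `|x - a t| < d / 2.
  by move/cvgrPdist_lt : ax => /(_ _ d2).
have hvd : \forall t \near G, `|h t *: v| < d / 2.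
  have : h t *: v @[t --> G] --> (0 : R) *: v by apply: cvgZl.
  rewrite scale0r => /cvgrPdist_lt /(_ _ d2); apply: filterS => t.
  by rewrite sub0r normrN.
near=> t.
have at_d : `|x - a t| < d / 2 by near: t.
have hv_d : `|h t *: v| < d / 2 by near: t.
have ht0 : h t != 0 by near: t.
have inball (s : R) : 0 <= s <= 1 -> ball x d (a t + s *: (h t *: v)).
  move=> s01; have := ball_segment (a t) hv_d s01.
  rewrite -!ball_normE /= => sd; rewrite [d]splitr -(subrK (a t) x) -addrA.
  by apply: le_lt_trans (ler_normD _ _) _; exact: ltrD.
have dv (s : R) : 0 <= s <= 1 -> derivable F (a t + s *: (h t *: v)) v.
  by move=> /inball /Hd [].
have [s /[dup] s01 /inball /Hd [_ /= close] ->] : exists2 s : R, 0 <= s <= 1 &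
    F (a t + h t *: v) - F (a t) = 'D_(h t *: v) F (a t + s *: (h t *: v)).
  by apply: mvt_line => s /dv ds; have [] := is_derive_dirZ (h t) ds.
have [_ ->] := is_derive_dirZ (h t) (dv _ s01).
by rewrite mulrA mulVf // mul1r.
Unshelve. all: by end_near. Qed.

(** The increment along [h *: (u + v)] is made in two moves, first [h *: u], then [h *: v]. The
    second starts at the moving point [x + h *: u], which is why [C1_increment] allows a variable
    base point. *)
Lemma C1_deriveD F x u v : C1_at F x ->
  'D_(u + v) F x = 'D_u F x + 'D_v F x.
Proof.
move=> cF; apply: cvg_lim => //=.
have h0 : (fun h : R => h) @ 0^' --> (0 : R) by exact: nbhs_dnbhs.
have hn0 : \forall h \near (0 : R)^', h != 0 by exact: nbhs_dnbhs_neq.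
have cu : h^-1 * (F (x + h *: u) - F x) @[h --> (0 : R)^'] --> 'D_u F x.
  by apply: (C1_increment (a := fun=> x) cF _ h0 hn0); exact: cvg_cst.
have xu : x + h *: u @[h --> 0^'] --> x.
  rewrite -[X in _ --> X]addr0 -[X in _ + X](scale0r u).
  by apply: cvgD; [exact: cvg_cst|exact: cvgZl].
have cv : h^-1 * (F (x + h *: u + h *: v) - F (x + h *: u))
    @[h --> (0 : R)^'] --> 'D_v F x.
  exact: (C1_increment cF xu h0 hn0).
apply: cvg_trans (cvgD cu cv); apply: near_eq_cvg; near=> h => /=.
rewrite -mulrDr; congr (_ * _); rewrite fctE addrC addrA subrK.
by congr (F _ - _); rewrite scalerDr [RHS]addrC addrA.
Unshelve. all: by end_near. Qed.

End C1Functions.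

(** * Chain rule and symmetry of second derivatives *)

Section ChainRuleSchwarz.
Context {R : realType}.

(** The mean value theorem for [F (_ + h *: v) - F] along [h *: u] turns the second difference into
    [h] times an increment of ['D_u F] along [h *: v], based at an intermediate point that tends to
    [x]; [C1_increment] then gives the limit. *)
Lemma second_difference_cvg {V : normedModType R} (F : V -> R) (x u v : V) :
  (\forall y \near x, derivable F y u) -> C1_at ('D_u F) x ->
  (h ^+ 2)^-1 * (F (x + h *: u + h *: v) - F (x + h *: u) -
    (F (x + h *: v) - F x)) @[h --> (0 : R)^'] --> 'D_v ('D_u F) x.
Proof.
move=> /nbhs_ballP [d /= d0 dF] cF.
pose seg (h s : R) := x + s *: (h *: u).
(* The derivability condition stays inside the existential so that an intermediate parameter can be
   chosen for every [h]; where the condition fails, [0] serves as default. *)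
have /choice [th Hth] : forall h : R, exists th : R, 0 <= th <= 1 /\
    ((forall s : R, 0 <= s <= 1 -> derivable F (seg h s) u /\
        derivable F (seg h s + h *: v) u) ->
     F (x + h *: u + h *: v) - F (x + h *: u) - (F (x + h *: v) - F x) =
     h * ('D_u F (seg h th + h *: v) - 'D_u F (seg h th))).
  move=> h; pose G := F \o shift (h *: v) - F.
  case: (pselect (forall s : R, 0 <= s <= 1 -> derivable F (seg h s) u /\
        derivable F (seg h s + h *: v) u)) => [dG|nd]; last first.
    by exists 0; split; rewrite ?lexx ?ler01// => /nd.
  have dsh y w : derivable F (y + h *: v) w ->
      is_derive y w (F \o shift (h *: v)) ('D_w F (y + h *: v)).
    move=> D; have e : (fun k : R => k^-1 *: (((F \o shift (h *: v)) \o shift y) (k *: w)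
         - (F \o shift (h *: v)) y)) =
        (fun k => k^-1 *: ((F \o shift (y + h *: v)) (k *: w) - F (y + h *: v))).
      by apply/funext => k /=; rewrite addrA.
    by split; [rewrite /derivable e|rewrite /derive e].
  have dGw (s : R) : 0 <= s <= 1 -> is_derive (seg h s) (h *: u) G
      (h * ('D_u F (seg h s + h *: v) - 'D_u F (seg h s))).
    move=> /dG [d1 d2]; have [e1 D1] := is_derive_dirZ h d1.
    have [e2 D2] := is_derive_dirZ h d2.
    apply: (is_derive_eq (@is_deriveB _ _ _ _ _ _ _ _ _ (dsh _ _ e2) (derivableP e1))).
    by rewrite D1 D2 mulrBr.
  have [s s01 e] : exists2 s : R, 0 <= s <= 1 &
      G (x + h *: u) - G x = 'D_(h *: u) G (seg h s).
    by apply: mvt_line => s s01; have [] := dGw s s01.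
  exists s; split => // _; have [_ <-] := dGw s s01.
  by rewrite -e /G /= !fctE /=.
have h0 : (fun h : R => h) @ 0^' --> (0 : R) by exact: nbhs_dnbhs.
have hn0 : \forall h \near (0 : R)^', h != 0 by exact: nbhs_dnbhs_neq.
have d2 : 0 < d / 2 by rewrite divr_gt0.
have small w : \forall h \near (0 : R)^', `|h *: w| < d / 2.
  have : h *: w @[h --> (0 : R)^'] --> (0 : R) *: w by exact: cvgZl.
  rewrite scale0r => /cvgrPdist_lt /(_ _ d2); apply: filterS => t.
  by rewrite sub0r normrN.
have sx : seg h (th h) @[h --> (0 : R)^'] --> x.
  have hu0 : h *: u @[h --> (0 : R)^'] --> (0 : V).
    by rewrite -[X in _ --> X](scale0r u); apply: cvgZl.
  apply/cvgrPdist_lt => e e0; have /cvgrPdist_lt/(_ e e0) := hu0.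
  apply: filterS => h; rewrite sub0r normrN => hu.
  by have := ball_segment x hu (Hth h).1; rewrite -ball_normE.
apply: cvg_trans (C1_increment (v := v) cF sx h0 hn0); apply: near_eq_cvg; near=> h.
have hnz : h != 0 by near: h.
have [_ ->] := Hth h; last first.
  move=> s s01.
  have hu : `|h *: u| < d / 2 by near: h; exact: small.
  have hv : `|h *: v| < d / 2 by near: h; exact: small.
  have := ball_segment x hu s01; rewrite -ball_normE /= => sd.
  split; apply: dF; rewrite -ball_normE /=.
    by apply: lt_trans sd _; rewrite ltr_pdivrMr // mulr_natr mulr2n ltrDl.
  rewrite opprD addrA [d]splitr; apply: le_lt_trans (ler_normB _ _) _.
  exact: ltrD.
by rewrite expr2 invfM -mulrA mulKf.
Unshelve. all: by end_near. Qed.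

(** The second difference is symmetric in [u] and [v], and both mixed derivatives are its limit. *)
Lemma derive_comm {V : normedModType R} (F : V -> R) (x u v : V) :
  (\forall y \near x, forall w, derivable F y w) ->
  C1_at ('D_u F) x -> C1_at ('D_v F) x ->
  'D_v ('D_u F) x = 'D_u ('D_v F) x.
Proof.
move=> dF cu cv; apply: cvg_unique (second_difference_cvg _ cu) _ => //.
  by apply: filterS dF => y.
have dFv : \forall y \near x, derivable F y v by apply: filterS dF => y.
have := second_difference_cvg (v := u) dFv cv.
apply: cvg_trans; apply: near_eq_cvg; near=> h => /=.
have -> : x + h *: v + h *: u = x + h *: u + h *: v by rewrite addrAC.
by congr (_ * _); rewrite !opprB; ring.
Unshelve. all: by end_near. Qed.

Lemma C1_derive_sum {V : normedModType R} (F : V -> R) x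
    (I : Type) (r : seq I) (w : I -> V) :
  C1_at F x -> 'D_(\sum_(i <- r) w i) F x = \sum_(i <- r) 'D_(w i) F x.
Proof.
by move=> cF; apply: (big_morph (fun v => 'D_v F x)) => [u v|];
  [exact: C1_deriveD|exact: derive0].
Qed.

Lemma C1_derive_partial d (F : 'rV[R]_d -> R) x v : C1_at F x ->
  'D_v F x = \sum_j v 0 j * 'D_(delta_mx 0 j) F x.
Proof.
move=> cF; rewrite {1}[v]row_sum_delta C1_derive_sum //.
apply: eq_bigr => j _; have dF : derivable F x (delta_mx 0 j).
  by have [/nbhs_singleton] := cF.
by have [_ ->] := is_derive_dirZ (v 0 j) dF.
Qed.

(** The increment [w h] of [T] has no fixed direction, so the mean value theorem is applied on the
    segment it spans and the derivative obtained there is expanded in partial derivatives before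
    passing to the limit. The expansion takes place at an intermediate point, hence [C1_at] in a
    whole neighbourhood of [T x]. *)
Lemma chain_rule {U : normedModType R} d (T : U -> 'rV[R]_d) (F : 'rV[R]_d -> R) x v :
  (\forall y \near T x, C1_at F y) -> {for x, continuous T} -> derivable T x v ->
  is_derive x v (F \o T) ('D_('D_v T x) F (T x)).
Proof.
move=> cF cT dT; pose w (h : R) := T (h *: v + x) - T x.
have [e /= e0 He] := (nbhs_ballP _ _).1 cF.
have /choice [th Hth] : forall h : R, exists th : R, 0 <= th <= 1 /\
    ((forall s : R, 0 <= s <= 1 -> C1_at F (T x + s *: w h)) ->
     F (T x + w h) - F (T x) = 'D_(w h) F (T x + th *: w h)).
  move=> h.
  case: (pselect (forall s : R, 0 <= s <= 1 -> C1_at F (T x + s *: w h)))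
    => [cw|nd]; last by exists 0; split; rewrite ?lexx ?ler01// => /nd.
  have [s s01 es] : exists2 s : R, 0 <= s <= 1 &
      F (T x + w h) - F (T x) = 'D_(w h) F (T x + s *: w h).
    by apply: mvt_line => s /cw [/nbhs_singleton].
  by exists s.
have w0 : w h @[h --> (0 : R)^'] --> (0 : 'rV[R]_d).
  rewrite -(subrr (T x)); apply: cvgB; last exact: cvg_cst.
  have hx : h *: v + x @[h --> (0 : R)^'] --> x.
    rewrite -[X in _ --> X]add0r -[X in _ --> X + _](scale0r v).
    by apply: cvgD; [apply: cvgZl; exact: nbhs_dnbhs|exact: cvg_cst].
  exact: (@cvg_comp _ _ _ (fun h : R => h *: v + x) T _ (nbhs x)).
have wsmall e' : 0 < e' -> \forall h \near (0 : R)^', `|w h| < e'.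
  move=> e'0; move/cvgrPdist_lt : w0 => /(_ _ e'0); apply: filterS => h.
  by rewrite sub0r normrN.
have yx : T x + th h *: w h @[h --> (0 : R)^'] --> T x.
  apply/cvgrPdist_lt => e' e'0; have := wsmall _ e'0.
  apply: filterS => h hw.
  by have := ball_segment (T x) hw (Hth h).1; rewrite -ball_normE.
have cFx : C1_at F (T x) by exact: nbhs_singleton cF.
have key : \sum_j (h^-1 *: w h) 0 j * 'D_(delta_mx 0 j) F (T x + th h *: w h)
    @[h --> (0 : R)^'] --> 'D_('D_v T x) F (T x).
  rewrite (C1_derive_partial _ cFx); apply: (cvg_big add_continuous) => j _.
  apply: cvgM.
    apply: (@cvg_comp _ _ _ (fun h : R => h^-1 *: w h) (fun A : 'rV[R]_d => A 0 j)
      _ (nbhs ('D_v T x))) => //.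
    exact: coord_continuous.
  apply: (@cvg_comp _ _ _ (fun h : R => T x + th h *: w h)
    ('D_(delta_mx 0 j) F) _ (nbhs (T x))) => //.
  by have [_] := cFx; apply.
have quot : (fun h : R => h^-1 *: (((F \o T) \o shift x) (h *: v) - (F \o T) x)) @ 0^'
    --> 'D_('D_v T x) F (T x).
  move: key; apply: cvg_trans; apply: near_eq_cvg; near=> h.
  have hw : `|w h| < e by near: h; exact: wsmall.
  have cy (s : R) : 0 <= s <= 1 -> C1_at F (T x + s *: w h).
    by move=> /(ball_segment (T x) hw) /He.
  have -> : ((F \o T) \o shift x) (h *: v) - (F \o T) x = F (T x + w h) - F (T x).
    by rewrite /= /w [T x + _]addrC subrK.
  rewrite (Hth h).2 // (C1_derive_partial _ (cy _ (Hth h).1)).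
  by rewrite [RHS]mulr_sumr; apply: eq_bigr => j _; rewrite mxE mulrA.
by split; [apply/cvg_ex; eexists; exact: quot|exact: cvg_lim quot].
Unshelve. all: by end_near. Qed.

End ChainRuleSchwarz.

(** * Smooth functions on open sets *)

Section CkClosure.
Context {R : realType} {d : nat}.
Implicit Types (A B : set 'rV[R]_d) (k : nat).

Section AnyCodomain.
Context {W : normedModType R}.
Implicit Types F G : 'rV[R]_d -> W.

Lemma Ck_on_continuous k A F x : Ck_on k A F -> A x -> {for x, continuous F}.
Proof. by case: k => [|k] [cF _]; exact: cF. Qed.

Lemma Ck_on_derivable k A F x v : Ck_on k.+1 A F -> A x -> derivable F x v.
Proof. by move=> [_ [dF _]]; exact: dF. Qed.

Lemma Ck_on_partial k A F v : Ck_on k.+1 A F -> Ck_on k A ('D_v F).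
Proof. by move=> [_ [_ DF]]; exact: DF. Qed.

Lemma Ck_on_sub k A B F : B `<=` A -> Ck_on k A F -> Ck_on k B F.
Proof.
move=> BA; elim: k F => [|k IH] F /=; first by move=> [cF _]; split=> // x /BA /cF.
move=> [cF [dF DF]]; split=> [x /BA /cF //|]; split=> [v x /BA|v]; first exact: dF.
exact: IH.
Qed.

(** Every clause of [Ck_on] is a pointwise condition on the total function [F], so gluing is
    immediate; this is used for extension by zero. *)
Lemma Ck_onU k A B F : Ck_on k A F -> Ck_on k B F -> Ck_on k (A `|` B) F.
Proof.
elim: k F => [|k IH] F /=.
  by move=> [cA _] [cB _]; split=> // x [/cA|/cB].
move=> [cA [dA DA]] [cB [dB DB]]; split=> [x [/cA|/cB] //|].
split=> [v x [/dA|/dB] //|v]; exact: IH.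
Qed.

Lemma Ck_onW k A F : Ck_on k.+1 A F -> Ck_on k A F.
Proof.
elim: k F => [|k IH] F [cF [dF DF]]; split=> //; split=> // v.
exact: IH.
Qed.

Lemma eq_on_near A F G x : open A -> {in A, F =1 G} -> A x ->
  \forall y \near x, F y = G y.
Proof.
move=> oA FG Ax; have : nbhs x A by exact: open_nbhs_nbhs.
by apply: filterS => y Ay; apply: FG; rewrite inE.
Qed.

Lemma near_eq_continuous F G x : (\forall y \near x, F y = G y) ->
  {for x, continuous F} -> {for x, continuous G}.
Proof.
move=> FG cF; rewrite /prop_for /continuous_at -(nbhs_singleton FG).
exact: cvg_trans (near_eq_cvg FG) cF.
Qed.

(** Openness makes the two functions agree near each point of [A], so their derivatives agree on [A]
    and the induction goes on. The closure lemmas below use it to replace a derivative by its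
    formula. *)
Lemma Ck_on_eq k A F G : open A -> {in A, F =1 G} -> Ck_on k A F -> Ck_on k A G.
Proof.
move=> oA; elim: k F G => [|k IH] F G FG.
  move=> [cF _]; split=> // x Ax.
  exact: near_eq_continuous (eq_on_near oA FG Ax) (cF x Ax).
move=> [cF [dF DF]]; split=> [x Ax|].
  exact: near_eq_continuous (eq_on_near oA FG Ax) (cF x Ax).
split=> [v x Ax|v].
  by apply: near_eq_derivable (dF v x Ax); exact: eq_on_near oA FG Ax.
apply: IH (DF v) => x; rewrite inE => Ax.
by apply: near_eq_derive; exact: eq_on_near oA FG Ax.
Qed.

Lemma Ck_on_cst k A (c : W) : Ck_on k A (cst c).
Proof.
elim: k c => [|k IH] c; split=> //; try by move=> x _; exact: cst_continuous.
split=> [v x _|v]; first exact: derivable_cst.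
by rewrite (_ : 'D_v (cst c) = cst 0) //; apply/funext => x; rewrite derive_cst.
Qed.

End AnyCodomain.

Implicit Types a b : 'rV[R]_d -> R.

Lemma Ck_onD k A a b : open A -> Ck_on k A a -> Ck_on k A b ->
  Ck_on k A (fun x => a x + b x).
Proof.
move=> oA; elim: k a b => [|k IH] a b.
  move=> [ca _] [cb _]; split=> // x Ax; exact: cvgD (ca x Ax) (cb x Ax).
move=> [ca [da Da]] [cb [db Db]]; split=> [x Ax|].
  by exact: cvgD (ca x Ax) (cb x Ax).
split=> [v x Ax|v]; first by apply: derivableD; [exact: da|exact: db].
apply: (Ck_on_eq oA _ (IH _ _ (Da v) (Db v))) => x; rewrite inE => Ax.
by symmetry; exact: (deriveD (da v x Ax) (db v x Ax)).
Qed.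

Lemma Ck_onM k A a b : open A -> Ck_on k A a -> Ck_on k A b ->
  Ck_on k A (fun x => a x * b x).
Proof.
move=> oA; elim: k a b => [|k IH] a b.
  move=> [ca _] [cb _]; split=> // x Ax; exact: cvgM (ca x Ax) (cb x Ax).
move=> /[dup] /Ck_onW a_k [ca [da Da]] /[dup] /Ck_onW b_k [cb [db Db]].
split=> [x Ax|]; first by exact: cvgM (ca x Ax) (cb x Ax).
split=> [v x Ax|v]; first by apply: derivableM; [exact: da|exact: db].
apply: (Ck_on_eq oA _ (Ck_onD oA (IH _ _ a_k (Db v)) (IH _ _ b_k (Da v)))) => x.
rewrite inE => Ax.
by symmetry; exact: (deriveM (da v x Ax) (db v x Ax)).
Qed.

Lemma Ck_onN k A a : open A -> Ck_on k A a -> Ck_on k A (fun x => - a x).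
Proof.
move=> oA Ca; apply: (Ck_on_eq oA _ (Ck_onM oA (Ck_on_cst k A (-1 : R)) Ca)).
by move=> x _; rewrite mulN1r.
Qed.

Lemma Ck_onB k A a b : open A -> Ck_on k A a -> Ck_on k A b ->
  Ck_on k A (fun x => a x - b x).
Proof. by move=> oA Ca Cb; apply: Ck_onD => //; exact: Ck_onN. Qed.

Lemma Ck_on_sum k A (I : Type) (r : seq I) (a : I -> 'rV[R]_d -> R) : open A ->
  (forall i, Ck_on k A (a i)) -> Ck_on k A (fun x => \sum_(i <- r) a i x).
Proof.
move=> oA Ca; elim: r => [|i r IH].
  by apply: (Ck_on_eq oA _ (Ck_on_cst k A (0 : R))) => x _; rewrite big_nil.
apply: (Ck_on_eq oA _ (Ck_onD oA (Ca i) IH)) => x _; by rewrite big_cons.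
Qed.

Lemma Ck_onV k A a : open A -> (forall x, A x -> a x != 0) -> Ck_on k A a ->
  Ck_on k A (fun x => (a x)^-1).
Proof.
move=> oA an0; elim: k => [|k IH].
  by move=> [ca _]; split=> // x Ax; exact: cvgV (an0 x Ax) (ca x Ax).
move=> /[dup] /Ck_onW a_k [ca [da Da]].
split=> [x Ax|]; first by exact: cvgV (an0 x Ax) (ca x Ax).
split=> [v x Ax|v]; first by apply: derivableV; [exact: an0|exact: da].
have Cv := IH a_k.
apply: (Ck_on_eq oA _ (Ck_onN oA (Ck_onM oA (Ck_onM oA Cv Cv) (Da v)))) => x.
rewrite inE => Ax; rewrite (deriveV (an0 x Ax) (da v x Ax)).
by rewrite -exprVn expr2 [RHS]mulNr.
Qed.

Lemma Ck_on_mxP k A p q (F : 'rV[R]_d -> 'M[R]_(p, q)) : open A ->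
  Ck_on k A F <-> forall i j, Ck_on k A (fun x => F x i j).
Proof.
move=> oA.
have contP (G : 'rV[R]_d -> 'M[R]_(p, q)) x : {for x, continuous G} <->
    forall i j, {for x, continuous (fun x => G x i j)}.
  split=> [cG i j|cG].
    by apply: (@continuous_comp _ _ _ G (fun M : 'M[R]_(p, q) => M i j));
      [exact: cG|exact: coord_continuous].
  apply/(@cvgrPdist_le _ _ _ _ (nbhs_filter x)) => /= e e0; near=> y.
  rewrite /Num.Def.normr/= mx_normrE (bigmax_le _ (ltW e0))//= => i _.
  rewrite !mxE/=; move: i; near: y; apply: filter_forall => /= i.
  by have /cvgrPdist_le := cG i.1 i.2; exact.
elim: k F => [|k IH] F.
  split=> [[cF _] i j|cF]; split=> // x Ax.
    exact: (contP F x).1 (cF x Ax) i j.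
  by apply: (contP F x).2 => i j; have [c _] := cF i j; exact: c.
split=> [[cF [dF DF]] i j|cF].
  split=> [x Ax|]; first exact: (contP F x).1 (cF x Ax) i j.
  split=> [v x Ax|v]; first by have /derivable_mxP := dF v x Ax; exact.
  apply: (Ck_on_eq oA _ ((IH ('D_v F)).1 (DF v) i j)) => x; rewrite inE => Ax.
  by rewrite (derive_mx (dF v x Ax)) mxE.
have dF v x : A x -> derivable F x v.
  by move=> Ax; apply/derivable_mxP => i j; have [_ []] := cF i j; move=> /(_ v x Ax).
split=> [x Ax|]; first by apply: (contP F x).2 => i j; have [c _] := cF i j; exact: c.
split=> // v; apply/IH => i j; have [_ [_ /(_ v)]] := cF i j.
apply: (Ck_on_eq oA) => x; rewrite inE => Ax.
by rewrite (derive_mx (dF v x Ax)) mxE.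
Unshelve. all: by end_near. Qed.

Lemma Ck_on_mulmx k A p q r (F : 'rV[R]_d -> 'M[R]_(p, q))
    (G : 'rV[R]_d -> 'M[R]_(q, r)) : open A ->
  Ck_on k A F -> Ck_on k A G -> Ck_on k A (fun x => F x *m G x).
Proof.
move=> oA /(Ck_on_mxP k F oA) CF /(Ck_on_mxP k G oA) CG.
apply/(Ck_on_mxP _ _ oA) => i j.
have := Ck_on_sum (index_enum 'I_q) oA (fun l => Ck_onM oA (CF i l) (CG l j)).
by apply: (Ck_on_eq oA) => x _; rewrite mxE.
Qed.

Lemma Ck_on_trmx k A p q (F : 'rV[R]_d -> 'M[R]_(p, q)) : open A ->
  Ck_on k A F -> Ck_on k A (fun x => (F x)^T).
Proof.
move=> oA /(Ck_on_mxP k F oA) CF; apply/(Ck_on_mxP _ _ oA) => i j.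
by apply: (Ck_on_eq oA _ (CF j i)) => x _; rewrite mxE.
Qed.

Lemma Ck_onD_mx k A p q (F G : 'rV[R]_d -> 'M[R]_(p, q)) : open A ->
  Ck_on k A F -> Ck_on k A G -> Ck_on k A (fun x => F x + G x).
Proof.
move=> oA /(Ck_on_mxP k F oA) CF /(Ck_on_mxP k G oA) CG.
apply/(Ck_on_mxP _ _ oA) => i j.
by apply: (Ck_on_eq oA _ (Ck_onD oA (CF i j) (CG i j))) => x _; rewrite mxE.
Qed.

Lemma Ck_onZ_mx k A p q (a : 'rV[R]_d -> R) (F : 'rV[R]_d -> 'M[R]_(p, q)) :
  open A -> Ck_on k A a -> Ck_on k A F -> Ck_on k A (fun x => a x *: F x).
Proof.
move=> oA Ca /(Ck_on_mxP k F oA) CF; apply/(Ck_on_mxP _ _ oA) => i j.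
by apply: (Ck_on_eq oA _ (Ck_onM oA Ca (CF i j))) => x _; rewrite mxE.
Qed.

Lemma Ck_on_sum_mx k A p q (I : Type) (r : seq I)
    (F : I -> 'rV[R]_d -> 'M[R]_(p, q)) : open A ->
  (forall i, Ck_on k A (F i)) -> Ck_on k A (fun x => \sum_(i <- r) F i x).
Proof.
move=> oA CF; apply/(Ck_on_mxP _ _ oA) => i j.
have Cij l : Ck_on k A (fun x => F l x i j).
  by have /(Ck_on_mxP k _ oA) := CF l; exact.
by apply: (Ck_on_eq oA _ (Ck_on_sum r oA Cij)) => x _; rewrite summxE.
Qed.

Lemma Ck_on_id k A : Ck_on k A id.
Proof.
have cid x : {for x, continuous (@id 'rV[R]_d)} by exact: cvg_id.
case: k => [|k]; split=> //; split=> [v x _|v]; first exact: derivable_id.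
rewrite (_ : 'D_v id = cst v); first exact: Ck_on_cst.
by apply/funext => x; rewrite derive_id.
Qed.

Lemma Ck_on_coord k A j : open A -> Ck_on k A (fun x => x 0 j).
Proof. by move=> oA; have /(Ck_on_mxP k _ oA) := Ck_on_id k A; exact. Qed.

Lemma Ck_on_C1_at k A a x : open A -> Ck_on k.+1 A a -> A x -> C1_at a x.
Proof.
move=> oA [ca [da Da]] Ax; split=> [|v].
  have : nbhs x A by exact: open_nbhs_nbhs.
  by apply: filterS => y Ay v; exact: da.
exact: Ck_on_continuous (Da v) Ax.
Qed.

Lemma Ck_on_near_C1 k A a x : open A -> Ck_on k.+1 A a -> A x ->
  \forall y \near x, C1_at a y.
Proof.
move=> oA Ca Ax; have : nbhs x A by exact: open_nbhs_nbhs.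
by apply: filterS => y; exact: Ck_on_C1_at Ca.
Qed.

End CkClosure.

Section CkComposition.
Context {R : realType} {c d : nat}.

(** A derivative of [a \o T] is a sum of products of coordinates of ['D_v T] with partial
    derivatives of [a] composed with [T], to which the induction applies. *)
Lemma Ck_on_comp k (A : set 'rV[R]_c) (B : set 'rV[R]_d) (T : 'rV[R]_c -> 'rV[R]_d)
    (a : 'rV[R]_d -> R) : open A -> open B -> (forall x, A x -> B (T x)) ->
  Ck_on k A T -> Ck_on k B a -> Ck_on k A (a \o T).
Proof.
move=> oA oB TAB; elim: k a => [|k IH] a.
  move=> [cT _] [ca _]; split=> // x Ax.
  by apply: continuous_comp; [exact: cT|exact/ca/TAB].
move=> /[dup] /Ck_onW T_k [cT [dT DT]] Ca; have [ca [da Da]] := Ca.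
have chain x v : A x -> is_derive x v (a \o T) ('D_('D_v T x) a (T x)).
  move=> Ax; apply: chain_rule; [|exact: cT|exact: dT].
  exact: Ck_on_near_C1 Ca (TAB x Ax).
split=> [x Ax|]; first by apply: continuous_comp; [exact: cT|exact/ca/TAB].
split=> [v x Ax|v]; first by have [] := chain x v Ax.
have /(Ck_on_mxP k _ oA)/(_ 0) DTv := DT v.
have := Ck_on_sum (index_enum 'I_d) oA
  (fun j => Ck_onM oA (DTv j) (IH _ T_k (Da (delta_mx 0 j)))).
apply: (Ck_on_eq oA) => x; rewrite inE => Ax.
have [_ ->] := chain x v Ax.
by rewrite (C1_derive_partial _ (Ck_on_C1_at oB Ca (TAB x Ax))).
Qed.

Lemma Ck_on_comp_mx k (A : set 'rV[R]_c) (B : set 'rV[R]_d) (T : 'rV[R]_c -> 'rV[R]_d)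
    p q (F : 'rV[R]_d -> 'M[R]_(p, q)) : open A -> open B -> (forall x, A x -> B (T x)) ->
  Ck_on k A T -> Ck_on k B F -> Ck_on k A (F \o T).
Proof.
move=> oA oB TAB CT /(Ck_on_mxP k F oB) CF; apply/(Ck_on_mxP _ _ oA) => i j.
exact: (Ck_on_comp oA oB TAB CT (CF i j)).
Qed.

End CkComposition.

(** * Square roots and flat functions *)

Section SpecialFunctions.
Context {R : realType}.

Lemma is_derive_comp_real {V : normedModType R} (a : V -> R) (rho : R -> R) x v (r : R) :
  is_derive (a x) 1 rho r -> derivable a x v ->
  is_derive x v (rho \o a) (r * 'D_v a x).
Proof.
move=> drho da; apply: is_derive_of_line.
have da0 : is_derive (0 : R) 1 (fun t : R => a (x + t *: v)) ('D_v a x).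
  have := @is_derive_line _ _ a x v 0; rewrite scale0r addr0; exact.
apply: (is_derive1_comp (f := rho) (g := fun t : R => a (x + t *: v))).
by rewrite scale0r addr0.
Qed.

Lemma Ck_on_sqrt d k (A : set 'rV[R]_d) (a : 'rV[R]_d -> R) : open A ->
  (forall x, A x -> 0 < a x) -> Ck_on k A a -> Ck_on k A (fun x => Num.sqrt (a x)).
Proof.
move=> oA a0; elim: k => [|k IH].
  move=> [ca _]; split=> // x Ax.
  by apply: continuous_comp; [exact: ca|exact: sqrt_continuous].
move=> /[dup] /Ck_onW a_k [ca [da Da]]; have Cs := IH a_k.
have der x v : A x -> is_derive x v (Num.sqrt \o a) ((2 * Num.sqrt (a x))^-1 * 'D_v a x).
  by move=> Ax; apply: is_derive_comp_real (da v x Ax); exact: is_derive1_sqrt (a0 x Ax).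
split=> [x Ax|].
  by apply: continuous_comp; [exact: ca|exact: sqrt_continuous].
split=> [v x Ax|v]; first by have [] := der x v Ax.
have sn0 x : A x -> 2 * Num.sqrt (a x) != 0.
  by move=> /a0 ax; rewrite mulf_neq0 // gt_eqF // sqrtr_gt0.
have := Ck_onM oA (Ck_onV oA sn0 (Ck_onM oA (Ck_on_cst k A (2 : R)) Cs)) (Da v).
apply: (Ck_on_eq oA) => x; rewrite inE => Ax.
by have [_ <-] := der x v Ax.
Qed.

(* [t^-n exp (-1/t)] for [t > 0], extended by [0]; the derivatives of these functions
   are combinations of functions of the same family. *)
Definition flat_exp n (t : R) := if 0 < t then t^-1 ^+ n * expR (- t^-1) else 0.

Lemma flat_exp_ge0 n t : 0 <= flat_exp n t.
Proof.
rewrite /flat_exp; case: ifPn => // t0.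
by rewrite mulr_ge0 ?expR_ge0 // exprn_ge0 // invr_ge0 ltW.
Qed.

(** From [s ^+ n.+2 / (n.+2)! <= expR s] at [s = t^-1]. The exponent [n.+2] leaves a factor
    [t ^+ 2], just enough for the derivative at [0] to vanish. *)
Lemma flat_exp_le n t : flat_exp n t <= (n.+2)`!%:R * t ^+ 2.
Proof.
rewrite /flat_exp; case: ifPn => [t0|_]; last first.
  by rewrite mulr_ge0 // sqr_ge0.
have ti0 : 0 < t^-1 by rewrite invr_gt0.
rewrite expRN ler_pdivrMr ?expR_gt0 //.
have fpos : 0 < (n.+2)`!%:R :> R by rewrite ltr0n fact_gt0.
have := expR_ge1Dxn n.+1 (ltW ti0).
rewrite addrC => /(le_trans _) le_e.
have {le_e} : t^-1 ^+ n.+2 / (n.+2)`!%:R <= expR t^-1.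
  by apply: le_e; rewrite lerDl.
rewrite ler_pdivrMr // => le_e.
rewrite -(ler_pM2r (exprn_gt0 2 ti0)) -exprD addn2.
apply: le_trans le_e _.
rewrite exprVn mulrAC mulfK ?expf_neq0 ?gt_eqF //.
by rewrite mulrC.
Qed.

(** The family is closed under differentiation, so smoothness follows by induction on the order for
    all [n] at once. At [0] the quadratic bound [flat_exp_le] decides. *)
Lemma is_derive_flat_exp n (t : R) :
  is_derive t 1 (flat_exp n) (flat_exp n.+2 t - n%:R * flat_exp n.+1 t).
Proof.
have [t0|t0|->] := ltgtP t 0.
- have -> : flat_exp n.+2 t - n%:R * flat_exp n.+1 t = 0.
    by rewrite /flat_exp ltNge (ltW t0) /= mulr0 subr0.
  apply: near_eq_is_derive (is_derive_cst 0 t 1).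
  near=> s; rewrite /flat_exp /cst ltNge ltW //.
  by near: s; exact: lt_nbhsl.
- have dinv : is_derive t 1 (fun s : R => s^-1) (- t^-1 ^+ 2).
    have tn0 : id t != 0 by rewrite gt_eqF.
    apply: (is_derive_eq (is_deriveV tn0 (is_derive_id t 1))).
    by rewrite [LHS]mulr1 exprVn.
  have de : is_derive t 1 (fun s : R => expR (- s^-1)) (t^-1 ^+ 2 * expR (- t^-1)).
    have dN : is_derive t 1 (fun s : R => - s^-1) (t^-1 ^+ 2).
      by apply: is_derive_eq; rewrite opprK.
    by have := is_derive1_comp (f := expR) (g := fun s : R => - s^-1)
      (is_derive_expR (- t^-1)) dN; rewrite mulrC.
  have dp : is_derive t 1 (fun s : R => s^-1 ^+ n) (- n%:R * t^-1 ^+ n.+1).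
    have -> : (fun s : R => s^-1 ^+ n) = (fun s : R => s^-1) ^+ n.
      by apply/funext => s; rewrite exprfctE.
    apply: (is_derive_eq (is_deriveX n dinv)).
    case: n => [|n]; first by rewrite /= oppr0 !mul0r scale0r.
    rewrite [LHS](_ : _ = (n.+1%:R * t^-1 ^+ n) * (- t^-1 ^+ 2)) // !exprS; ring.
  apply: (near_eq_is_derive _ (is_derive_eq (is_deriveM dp de) _)).
    near=> s; rewrite /flat_exp ifT //; near: s; exact: lt_nbhsr.
  rewrite [LHS](_ : _ = t^-1 ^+ n * (t^-1 ^+ 2 * expR (- t^-1)) +
    expR (- t^-1) * (- n%:R * t^-1 ^+ n.+1)) // /flat_exp t0 !exprS; ring.
- have -> : flat_exp n.+2 0 - n%:R * flat_exp n.+1 0 = 0.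
    by rewrite /flat_exp ltxx mulr0 subr0.
  have f0 : flat_exp n 0 = 0 by rewrite /flat_exp ltxx.
  have lim0 : (fun h : R => h^-1 *: ((flat_exp n \o shift 0) (h *: 1) - flat_exp n 0))
      @ 0^' --> (0 : R).
    have fpos : 0 < (n.+2)`!%:R :> R by rewrite ltr0n fact_gt0.
    apply/cvgrPdist_lt => e e0; near=> h.
    rewrite sub0r normrN /= addr0 f0 subr0 normrM [h *: 1]mulr1.
    have hn0 : h != 0 by near: h; exact: nbhs_dnbhs_neq.
    rewrite (ger0_norm (flat_exp_ge0 n h)) normfV ltr_pdivrMl ?normr_gt0 //.
    apply: le_lt_trans (flat_exp_le n h) _.
    rewrite -normr_id -[h ^+ 2]ger0_norm ?sqr_ge0 // normrX expr2 mulrA normr_id.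
    rewrite [ltRHS]mulrC ltr_pM2r ?normr_gt0 // mulrC -ltr_pdivlMr //.
    by near: h; apply: dnbhs0_lt; exact: divr_gt0.
  by split; [apply/cvg_ex; exists 0|exact: cvg_lim lim0].
Unshelve. all: by end_near. Qed.

Lemma Ck_on_flat_exp d k (A : set 'rV[R]_d) (a : 'rV[R]_d -> R) n : open A ->
  Ck_on k A a -> Ck_on k A (fun x => flat_exp n (a x)).
Proof.
have cont m : continuous (flat_exp m).
  move=> t; apply: differentiable_continuous; apply/derivable1_diffP.
  by have [] := is_derive_flat_exp m t.
move=> oA; elim: k n => [|k IH] n.
  by move=> [ca _]; split=> // x Ax; apply: continuous_comp; [exact: ca|exact: cont].
move=> /[dup] /Ck_onW a_k [ca [da Da]].
have der x v : A x -> is_derive x v (flat_exp n \o a)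
    ((flat_exp n.+2 (a x) - n%:R * flat_exp n.+1 (a x)) * 'D_v a x).
  by move=> Ax; apply: is_derive_comp_real (da v x Ax); exact: is_derive_flat_exp.
split=> [x Ax|]; first by apply: continuous_comp; [exact: ca|exact: cont].
split=> [v x Ax|v]; first by have [] := der x v Ax.
have := Ck_onM oA (Ck_onB oA (IH n.+2 a_k)
  (Ck_onM oA (Ck_on_cst k A (n%:R : R)) (IH n.+1 a_k))) (Da v).
apply: (Ck_on_eq oA) => x; rewrite inE => Ax.
by have [_ <-] := der x v Ax.
Qed.

End SpecialFunctions.

(* The chained [etrans] below avoid [rewrite]: comparing two distinct iterated
   derivatives up to conversion is prohibitively slow. *)
Section Partials.
Context {R : realType} {d : nat}.
Implicit Types (A : set 'rV[R]_d).

Lemma derive_mxE (U : normedModType R) p q (F : U -> 'M[R]_(p, q)) x v i j :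
  derivable F x v -> ('D_v F x) i j = 'D_v (fun y => F y i j) x.
Proof. by move=> dF; rewrite derive_mx // mxE. Qed.

Lemma derive_partial_mx k A p q (F : 'rV[R]_d -> 'M[R]_(p, q)) x v : open A ->
  Ck_on k.+1 A F -> A x -> 'D_v F x = \sum_j v 0 j *: 'D_(delta_mx 0 j) F x.
Proof.
move=> oA CF Ax; have dF w : derivable F x w := Ck_on_derivable CF Ax.
have /(Ck_on_mxP _ _ oA) CFij := CF.
apply/matrixP => i l; rewrite (derive_mxE _ _ (dF v)) summxE.
rewrite (C1_derive_partial _ (Ck_on_C1_at oA (CFij i l) Ax)).
by apply: eq_bigr => j _; rewrite mxE (derive_mxE _ _ (dF _)).
Qed.

Lemma deriveD_dir k A p q (F : 'rV[R]_d -> 'M[R]_(p, q)) x u v : open A ->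
  Ck_on k.+1 A F -> A x -> 'D_(u + v) F x = 'D_u F x + 'D_v F x.
Proof.
move=> oA CF Ax; rewrite !(derive_partial_mx _ oA CF Ax) -big_split /=.
by apply: eq_bigr => j _; rewrite mxE scalerDl.
Qed.

Lemma deriveZ_dir k A p q (F : 'rV[R]_d -> 'M[R]_(p, q)) x (a : R) v : open A ->
  Ck_on k.+1 A F -> A x -> 'D_(a *: v) F x = a *: 'D_v F x.
Proof.
move=> oA CF Ax; rewrite !(derive_partial_mx _ oA CF Ax) scaler_sumr.
by apply: eq_bigr => j _; rewrite mxE scalerA.
Qed.

Lemma chain_rule_mx (U : normedModType R) k A p q (T : U -> 'rV[R]_d)
    (F : 'rV[R]_d -> 'M[R]_(p, q)) x v : open A ->
  Ck_on k.+1 A F -> A (T x) -> {for x, continuous T} -> derivable T x v ->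
  is_derive x v (F \o T) ('D_('D_v T x) F (T x)).
Proof.
move=> oA CF ATx cT dT; have dF w : derivable F (T x) w := Ck_on_derivable CF ATx.
have /(Ck_on_mxP _ _ oA) CFij := CF.
have chain i l : is_derive x v (fun y => F (T y) i l)
    ('D_('D_v T x) (fun y => F y i l) (T x)).
  apply: (chain_rule (F := fun y => F y i l)) => //.
  exact: Ck_on_near_C1 (CFij i l) ATx.
have dFT : derivable (F \o T) x v.
  by apply/derivable_mxP => i l; have [] := chain i l.
split; first exact: dFT.
apply/matrixP => i l; apply: etrans (derive_mxE i l dFT) _.
apply: etrans (esym (derive_mxE i l (dF ('D_v T x)))).
by have [_] := chain i l.
Qed.

(** The transposed Jacobian matrix, since tangent vectors are rows and matrices act on the right. *)
Definition partials q (F : 'rV[R]_d -> 'rV[R]_q) (x : 'rV[R]_d) : 'M[R]_(d, q) :=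
  \matrix_j 'D_(delta_mx 0 j) F x.

Lemma derive_partials k A q (F : 'rV[R]_d -> 'rV[R]_q) x v : open A ->
  Ck_on k.+1 A F -> A x -> 'D_v F x = v *m partials F x.
Proof.
move=> oA CF Ax; rewrite (derive_partial_mx _ oA CF Ax) mulmx_sum_row.
by apply: eq_bigr => j _; rewrite rowK.
Qed.

Lemma Ck_on_partials k A q (F : 'rV[R]_d -> 'rV[R]_q) : open A ->
  Ck_on k.+1 A F -> Ck_on k A (partials F).
Proof.
move=> oA CF; apply/(Ck_on_mxP _ _ oA) => i j.
have /(Ck_on_mxP _ _ oA) C := Ck_on_partial (delta_mx 0 i) CF.
by apply: (Ck_on_eq oA _ (C 0 j)) => x _; rewrite mxE.
Qed.

Lemma derive_comm_mx k A p q (F : 'rV[R]_d -> 'M[R]_(p, q)) x u v : open A ->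
  Ck_on k.+2 A F -> A x -> 'D_v ('D_u F) x = 'D_u ('D_v F) x.
Proof.
move=> oA CF Ax; have /(Ck_on_mxP _ _ oA) CFij := CF.
have dF w y : A y -> derivable F y w by exact: Ck_on_derivable CF.
have ddF w w' : derivable ('D_w F) x w'.
  by have Cw := Ck_on_partial w CF; exact: (Ck_on_derivable Cw Ax).
apply/matrixP => i j; apply: etrans (derive_mxE i j (ddF u v)) _.
apply: etrans (esym (derive_mxE i j (ddF v u))).
have swap w w' : 'D_w' (fun y => 'D_w F y i j) x = 'D_w' ('D_w (fun y => F y i j)) x.
  apply: near_eq_derive; have : nbhs x A by exact: open_nbhs_nbhs.
  by apply: filterS => y Ay; rewrite (derive_mxE _ _ (dF w y Ay)).
apply: etrans (swap u v) _; apply: etrans (esym (swap v u)); apply: derive_comm.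
- have : nbhs x A by exact: open_nbhs_nbhs.
  by apply: filterS => y Ay w; exact: Ck_on_derivable (CFij i j) Ay.
- have Cu := Ck_on_partial u (CFij i j); exact: (Ck_on_C1_at oA Cu Ax).
- have Cv := Ck_on_partial v (CFij i j); exact: (Ck_on_C1_at oA Cv Ax).
Qed.

End Partials.

(** * Fields on a manifold *)

Section Charts.
Context {R : realType} {d : nat} {M : manifold R d}.
Implicit Types (i j k : chart M) (p q : M) (U : set M).

Lemma cmap_image_open i U : open U -> open (cmap i @` (cdom i `&` U)).
Proof.
move=> oU.
have -> : cmap i @` (cdom i `&` U) = (cmap i @` cdom i) `&` (cinv i @^-1` U).
  apply/seteqP; split=> [_ [p [ip Up] <-]|_ [[p ip <-]]].
    by split; [exists p|rewrite /= cmapK].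
  by rewrite /= cmapK // => Up; exists p.
rewrite openE => x [ix Ux]; rewrite /interior; apply: filterI.
  by apply: open_nbhs_nbhs; split=> //; exact: cmap_open.
by have := cinv_continuous ix; apply; exact: open_nbhs_nbhs.
Qed.

Lemma cmap_preimage_open i (B : set 'rV[R]_d) : open B ->
  open (cdom i `&` cmap i @^-1` B).
Proof.
move=> oB; rewrite openE => p [ip Bp]; rewrite /interior; apply: filterI.
  by apply: open_nbhs_nbhs; split=> //; exact: cdom_open.
by have := cmap_continuous ip; apply; exact: open_nbhs_nbhs.
Qed.

Lemma near_cmapK i p : cdom i p -> \forall x \near cmap i p, cmap i (cinv i x) = x.
Proof.
move=> ip; have : nbhs (cmap i p) (cmap i @` cdom i).
  by apply: open_nbhs_nbhs; split; [exact: cmap_open|exists p].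
by apply: filterS => _ [q iq <-]; rewrite cmapK.
Qed.

Lemma change_id i p v : cdom i p -> change i i p v = v.
Proof.
move=> ip; rewrite /change /cderiv -[RHS](derive_id (cmap i p) v).
by apply: near_eq_derive; exact: near_cmapK.
Qed.

Lemma overlap_open i j : open (cmap i @` (cdom i `&` cdom j)).
Proof. by apply: cmap_image_open; exact: cdom_open. Qed.

Lemma change_partials i j p v : cdom i p -> cdom j p ->
  change i j p v = v *m partials (cmap j \o cinv i) (cmap i p).
Proof.
move=> ip jp; apply: derive_partials (@overlap_open i j) (transition_smooth i j 1%N) _.
by exists p.
Qed.

Lemma change_comp i j k p v : cdom i p -> cdom j p -> cdom k p ->
  change j k p (change i j p v) = change i k p v.
Proof.
move=> ip jp kp; rewrite /change /cderiv.
have Ti := transition_smooth i j 1%N.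
have Aij : (cmap i @` (cdom i `&` cdom j)) (cmap i p) by exists p.
have [_ <-] : is_derive (cmap i p) v ((cmap k \o cinv j) \o (cmap j \o cinv i))
    ('D_('D_v (cmap j \o cinv i) (cmap i p)) (cmap k \o cinv j) (cmap j p)).
  rewrite -{2}(cmapK ip).
  apply: (chain_rule_mx (@overlap_open j k) (transition_smooth j k 1%N)).
  - by rewrite /= cmapK //; exists p.
  - exact: Ck_on_continuous Ti Aij.
  - exact: Ck_on_derivable Ti Aij.
apply: near_eq_derive.
have : nbhs (cmap i p) (cmap i @` (cdom i `&` cdom j)).
  by apply: open_nbhs_nbhs; split=> //; exact: (@overlap_open i j).
by apply: filterS => _ [q [iq jq] <-]; rewrite /= !cmapK.
Qed.

Lemma csmooth_sub {W : normedModType R} U V i (F : M -> W) : V `<=` U ->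
  csmooth U i F -> csmooth V i F.
Proof.
move=> VU sF k; apply: Ck_on_sub (sF k) => _ [p [ip Vp] <-].
by exists p => //; split=> //; exact: VU.
Qed.

(** In a chart [j] the components are [Y] in the coordinates of [i] times the Jacobian of the
    transition map, both composed with the inverse transition; compatibility is [change_comp]. *)
Lemma vfield_from_chart i U (Y : M -> 'rV[R]_d) : open U -> U `<=` cdom i ->
  csmooth U i Y -> vfield_on U (fun j p => change i j p (Y p)).
Proof.
move=> oU Ui sY; split=> [j k|j k p Up jp kp]; last first.
  by rewrite change_comp //; exact: Ui.
set A := cmap j @` _; have oA : open A by exact: cmap_image_open.
set B := cmap i @` (cdom i `&` U); have oB : open B by exact: cmap_image_open.
have BAij : forall x, A x -> (cmap i @` (cdom i `&` cdom j)) ((cmap i \o cinv j) x).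
  by move=> _ [p [jp /Ui ip] <-]; rewrite /= cmapK //; exists p.
have BAU : forall x, A x -> B ((cmap i \o cinv j) x).
  by move=> _ [p [jp Up] <-]; rewrite /= cmapK //; exists p => //; split=> //; exact: Ui.
have sT : Ck_on k A (cmap i \o cinv j).
  apply: Ck_on_sub (transition_smooth j i k) => _ [p [jp /Ui ip] <-].
  by exists p.
have sJ := Ck_on_comp_mx oA (@overlap_open i j) BAij sT
  (Ck_on_partials (@overlap_open i j) (transition_smooth i j k.+1)).
have sYT := Ck_on_comp_mx oA oB BAU sT (sY k).
apply: (Ck_on_eq oA _ (Ck_on_mulmx oA sYT sJ)) => x; rewrite inE => -[p [jp Up] <-].
have ip := Ui _ Up.
by rewrite /= cmapK // cmapK // change_partials.
Qed.

(** Extension by zero: the domain of [i] and the complement of [K] are open and cover [M], and the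
    field is smooth on each of them. *)
Lemma vfield_from_chart_global i (K : set M) (Y : M -> 'rV[R]_d) : closed K ->
  K `<=` cdom i -> csmooth (cdom i) i Y -> (forall p, cdom i p -> ~ K p -> Y p = 0) ->
  vfield_on setT (fun j p => if `[< cdom i p >] then change i j p (Y p) else 0).
Proof.
move=> cK Ki sY Y0.
have [sX cX] := vfield_from_chart (cdom_open i) (@subset_refl _ _) sY.
split=> [j k|j k p _ jp kp]; last first.
  case: asboolP => ip; first exact: cX.
  by rewrite /= change_partials // mul0mx.
have oi : open (cmap j @` (cdom j `&` cdom i)) by exact: overlap_open.
have oK : open (cmap j @` (cdom j `&` ~` K)).
  by apply: cmap_image_open; exact: closed_openC.
apply: (@Ck_on_sub _ _ _ _
  (cmap j @` (cdom j `&` cdom i) `|` cmap j @` (cdom j `&` ~` K))).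
  move=> _ [p [jp _] <-]; case: (pselect (K p)) => Kp; last by right; exists p.
  by left; exists p => //; split=> //; exact: Ki.
apply: Ck_onU.
  apply: (Ck_on_eq oi _ (sX j k)) => x; rewrite inE => -[p [jp ip] <-].
  by rewrite /= cmapK // asboolT.
apply: (Ck_on_eq oK _ (Ck_on_cst k _ (0 : 'rV[R]_d))) => x.
rewrite inE => -[p [jp Kp] <-].
rewrite /= cmapK //; case: asboolP => // ip.
by rewrite Y0 // change_partials // mul0mx.
Qed.

Lemma exists_bump i p : cdom i p -> exists (psi : M -> R) (K : set M),
  [/\ csmooth (cdom i) i psi, psi p != 0, closed K, K `<=` cdom i &
      forall q, cdom i q -> ~ K q -> psi q = 0].
Proof.
move=> ip; pose c := cmap i p.
have : nbhs c (cmap i @` cdom i).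
  by apply: open_nbhs_nbhs; split; [exact: cmap_open|exists p].
move=> /nbhs_ballP [e /= e0 Be]; pose r := e / 2.
have r0 : 0 < r by rewrite divr_gt0.
(* A cube, as a product of segments, is compact, and it is a closed ball for the norm of row
   vectors; its image in [M] is closed because [M] is Hausdorff. The cut-off uses the Euclidean
   [dist2], which is smooth; outside the cube one coordinate already makes it exceed [r * r]. *)
pose box : set 'rV[R]_d := [set x | forall l, `[c 0 l - r, c 0 l + r]%classic (x 0 l)].
have box_image : box `<=` cmap i @` cdom i.
  move=> x bx; apply: Be; rewrite -ball_normE /=.
  apply: (@le_lt_trans _ _ r); last by rewrite /r ltr_pdivrMr // mulr_natr mulr2n ltrDl.
  rewrite /Num.Def.normr /= mx_normrE (bigmax_le _ (ltW r0)) //= => -[a l] _.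
  rewrite !mxE ord1; have := bx l; rewrite /= in_itv /= => /andP[b1 b2].
  by rewrite ler_norml lerBlDr -lerBlDl lerBrDr addrC lerBlDr; lra.
pose dist2 (x : 'rV[R]_d) := \sum_l (x 0 l - c 0 l) * (x 0 l - c 0 l).
exists (fun q => flat_exp 0 (r * r - dist2 (cmap i q))), (cinv i @` box); split.
- move=> k; have oi : open (cmap i @` (cdom i `&` cdom i)) := @overlap_open i i.
  have Cd : Ck_on k (cmap i @` (cdom i `&` cdom i)) (fun x => r * r - dist2 x).
    apply: Ck_onB => //; first exact: (Ck_on_cst k _ (r * r)).
    apply: Ck_on_sum => // l; have Cl : Ck_on k (cmap i @` (cdom i `&` cdom i))
        (fun x => x 0 l - c 0 l).
      by apply: Ck_onB => //; [exact: Ck_on_coord|exact: (Ck_on_cst k _ (c 0 l))].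
    exact: Ck_onM.
  apply: (Ck_on_eq oi _ (Ck_on_flat_exp 0 oi Cd)) => x; rewrite inE => -[q [iq _] <-].
  by rewrite /= cmapK.
- rewrite /dist2 big1 => [|l _]; last by rewrite subrr mul0r.
  rewrite subr0 /flat_exp mulr_gt0 // expr0 mul1r gt_eqF //; exact: expR_gt0.
- apply: compact_closed; first exact: manifold_hausdorff.
  apply: continuous_compact.
    apply: continuous_in_subspaceT => x; rewrite inE => /box_image.
    exact: cinv_continuous.
  apply: (@rV_compact _ _ (fun l => `[c 0 l - r, c 0 l + r]%classic)) => l.
  exact: segment_compact.
- by move=> _ [x /box_image [q iq <-] <-]; rewrite cmapK.
- move=> q iq nK.
  have [l nl] : exists l, ~ `[c 0 l - r, c 0 l + r]%classic (cmap i q 0 l).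
    by apply/existsNP => bq; apply: nK; exists (cmap i q) => //; rewrite cmapK.
  rewrite /flat_exp ltNge (_ : _ <= 0) // subr_le0 /dist2 (bigD1 l) //=.
  apply: (@le_trans _ _ ((cmap i q 0 l - c 0 l) * (cmap i q 0 l - c 0 l))); last first.
    by rewrite lerDl sumr_ge0 // => l' _; rewrite -expr2 sqr_ge0.
  move/negP: nl; rewrite /= in_itv /= negb_and -!ltNge => /orP[h|h]; nra.
Qed.

End Charts.

(** * Almost contact metric structures *)

Section InnerProduct.
Context {R : realType} {d : nat}.
Implicit Types (G : 'M[R]_d) (u v w : 'rV[R]_d) (a : 'cV[R]_d) (c : R).

Lemma innerDl G u v w : inner G (u + v) w = inner G u w + inner G v w.
Proof. by rewrite /inner !mulmxDl mxE. Qed.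

Lemma innerDr G u v w : inner G u (v + w) = inner G u v + inner G u w.
Proof. by rewrite /inner linearD /= mulmxDr mxE. Qed.

Lemma innerZl G c u v : inner G (c *: u) v = c * inner G u v.
Proof. by rewrite /inner -!scalemxAl mxE. Qed.

Lemma innerZr G c u v : inner G u (c *: v) = c * inner G u v.
Proof. by rewrite /inner linearZ /= -scalemxAr mxE. Qed.

Lemma innerNl G u v : inner G (- u) v = - inner G u v.
Proof. by rewrite -scaleN1r innerZl mulN1r. Qed.

Lemma innerNr G u v : inner G u (- v) = - inner G u v.
Proof. by rewrite -scaleN1r innerZr mulN1r. Qed.

Lemma inner0l G v : inner G 0 v = 0.
Proof. by rewrite /inner !mul0mx mxE. Qed.

Lemma inner_suml G v (I : Type) (r : seq I) (u : I -> 'rV[R]_d) :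
  inner G (\sum_(i <- r) u i) v = \sum_(i <- r) inner G (u i) v.
Proof.
by apply: (big_morph (fun x => inner G x v)) => [x y|]; [exact: innerDl|exact: inner0l].
Qed.

Lemma inner_sym G u v : G^T = G -> inner G u v = inner G v u.
Proof.
move=> sG; rewrite /inner -[in LHS](trmxK (u *m G *m v^T)) [LHS]mxE.
by rewrite !trmx_mul trmxK sG mulmxA.
Qed.

Lemma pairingD u v a : pairing (u + v) a = pairing u a + pairing v a.
Proof. by rewrite /pairing mulmxDl mxE. Qed.

Lemma pairingZ c u a : pairing (c *: u) a = c * pairing u a.
Proof. by rewrite /pairing -scalemxAl mxE. Qed.

Lemma pairingZr c u a : pairing u (c *: a) = c * pairing u a.
Proof. by rewrite /pairing -scalemxAr mxE. Qed.

Lemma pairingN u a : pairing (- u) a = - pairing u a.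
Proof. by rewrite -scaleN1r pairingZ mulN1r. Qed.

Lemma pairing0 a : pairing 0 a = 0.
Proof. by rewrite /pairing mul0mx mxE. Qed.

Lemma pairing_sum a (I : Type) (r : seq I) (u : I -> 'rV[R]_d) :
  pairing (\sum_(i <- r) u i) a = \sum_(i <- r) pairing (u i) a.
Proof.
by apply: (big_morph (fun x => pairing x a)) => [x y|];
  [exact: pairingD|exact: pairing0].
Qed.

Lemma inner_row G u k (F : 'M[R]_(k, d)) l : inner G u (row l F) = (u *m G *m F^T) 0 l.
Proof.
rewrite /inner [LHS]mxE [RHS]mxE; apply: eq_bigr => j _; congr (_ * _).
by rewrite !mxE.
Qed.

End InnerProduct.

Section AlmostContactAlgebra.
Context {R : realType} {m : nat} {M : manifold R m.*2.+1} (A : acm_structure M).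
Variables (i : chart M) (p : M) (ip : cdom i p).

Local Notation phi := (acm_phi A i p).
Local Notation xi := (acm_xi A i p).
Local Notation eta := (acm_eta A i p).
Local Notation g := (acm_g A i p).

Lemma acm_g_sym u v : inner g u v = inner g v u.
Proof. by apply: inner_sym; have [_ _ sym _] := acm_g_metric A; exact: sym. Qed.

Lemma acm_g_gt0 v : v != 0 -> 0 < inner g v v.
Proof. by have [_ _ _ pos] := acm_g_metric A; exact: pos. Qed.

(** As [phi^2 xi = 0], the formula for [phi^2] at [phi xi] gives [phi xi = a xi] with
    [a = eta (phi xi)]; applying [phi] again gives [a^2 = 0]. *)
Lemma acm_xi_phi : xi *m phi = 0.
Proof.
have sq0 : xi *m phi *m phi = 0.
  by rewrite acm_phi_sq // acm_eta_xi // scale1r addrC subrr.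
have e1 : xi *m phi = pairing (xi *m phi) eta *: xi.
  have : xi *m phi *m phi *m phi = 0 by rewrite sq0 mul0mx.
  by rewrite acm_phi_sq // addrC => /eqP; rewrite subr_eq0 => /eqP.
have e2 : pairing (xi *m phi) eta * pairing (xi *m phi) eta = 0.
  have : pairing (xi *m phi *m phi) eta = 0 by rewrite sq0 pairing0.
  rewrite e1 -scalemxAl pairingZ e1 !pairingZ acm_eta_xi // !mulr1.
  by rewrite {1}e1 pairingZ acm_eta_xi // mulr1.
move/eqP : e2; rewrite mulf_eq0 orbb => /eqP e2.
by rewrite e1 e2 scale0r.
Qed.

Lemma acm_xi_neq0 : xi != 0.
Proof.
by apply: contra_eq_neq (acm_eta_xi A ip) => ->; rewrite pairing0 eq_sym oner_eq0.
Qed.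

(** Two computations of [phi^3 v] differ by [eta (phi v) xi]. *)
Lemma acm_eta_phi v : pairing (v *m phi) eta = 0.
Proof.
have : v *m phi *m phi *m phi = - (v *m phi).
  by rewrite (acm_phi_sq _ v) // mulmxDl -scalemxAl acm_xi_phi scaler0 addr0 mulNmx.
rewrite acm_phi_sq // -[RHS]addr0 => /addrI /eqP.
by rewrite scaler_eq0 (negPf acm_xi_neq0) orbF => /eqP.
Qed.

Lemma acm_g_xi v : inner g v xi = pairing v eta.
Proof.
have := acm_compatible A v xi ip.
rewrite acm_xi_phi acm_eta_xi // mulr1 acm_g_sym inner0l.
by move/esym/eqP; rewrite subr_eq0 => /eqP.
Qed.

Lemma acm_phi_skew u v : inner g (u *m phi) v = - inner g u (v *m phi).
Proof.
have := acm_compatible A u (v *m phi) ip.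
rewrite acm_eta_phi mulr0 subr0 => <-.
by rewrite acm_phi_sq // innerDr innerNr innerZr acm_g_xi acm_eta_phi mulr0 addr0 opprK.
Qed.

Lemma acm_phi_orth v : inner g v (v *m phi) = 0.
Proof.
have := acm_phi_skew v v; rewrite acm_g_sym => /eqP.
by rewrite -addr_eq0 -mulr2n mulrn_eq0 => /eqP.
Qed.

Lemma acm_g_phi_phi u v : pairing u eta = 0 ->
  inner g (u *m phi) (v *m phi) = inner g u v.
Proof. by move=> u0; rewrite acm_compatible // u0 mul0r subr0. Qed.

Lemma acm_phi_sq_D v : pairing v eta = 0 -> v *m phi *m phi = - v.
Proof. by move=> v0; rewrite acm_phi_sq // v0 scale0r addr0. Qed.

(* [e] spans with [phi e] and [xi] only [2 k + 1 < 2 m + 1] dimensions. *)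
Lemma acm_new_frame_vector (k : nat) (e : 'I_k -> 'rV[R]_(m.*2.+1)) : (k < m)%N ->
  exists2 v, v != 0 & [/\ pairing v eta = 0, forall l, inner g v (e l) = 0 &
    forall l, inner g v (e l *m phi) = 0].
Proof.
move=> km; pose E := \matrix_l e l.
pose C := row_mx eta (row_mx (g *m E^T) (g *m (E *m phi)^T)).
have /rowV0Pn [v /sub_kermxP vC v0] : kermx C != 0.
  rewrite kermx_eq0; apply/negP => /eqP rC.
  have := rank_leq_col C; rewrite rC; lia.
exists v => //; move: vC; rewrite /C !mul_mx_row -[0]hsubmxK => /eq_row_mx [veta].
rewrite -[RHS]hsubmxK => /eq_row_mx [v1 v2].
have col_inner (F : 'M[R]_(k, m.*2.+1)) l :
    v *m (g *m F^T) = 0 -> inner g v (row l F) = 0.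
  by rewrite mulmxA => /matrixP/(_ 0 l); rewrite inner_row => ->; rewrite mxE.
split=> [|l|l].
- by rewrite /pairing veta !mxE.
- rewrite -[e l](rowK (fun l => e l)) col_inner // v1.
  by apply/matrixP => a b; rewrite !mxE.
- have -> : e l *m phi = row l (E *m phi) by rewrite row_mul rowK.
  by rewrite col_inner // v2; apply/matrixP => a b; rewrite !mxE.
Qed.

(** The products of the [phi e_l] with one another are not listed: on [D] they equal those of the
    [e_l], by [acm_g_phi_phi]. *)
Definition phi_orthonormal k (e : 'I_k -> 'rV[R]_(m.*2.+1)) := forall l,
  pairing (e l) eta = 0 /\ forall l',
    inner g (e l) (e l') = (l == l')%:R /\ inner g (e l) (e l' *m phi) = 0.

(* Gram-Schmidt step. *)
Definition frame_residual k (e : 'I_k -> 'rV[R]_(m.*2.+1)) v :=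
  - (v *m phi *m phi) + - \sum_l
    (inner g (- (v *m phi *m phi)) (e l) *: e l +
     inner g (- (v *m phi *m phi)) (e l *m phi) *: (e l *m phi)).

(** The residual starts from [- phi^2 v], the projection of [v] onto [D], because [v] will be
    constant in a chart and known to lie in [D] at one point only. *)
Lemma frame_residual_D k (e : 'I_k -> 'rV[R]_(m.*2.+1)) v :
  phi_orthonormal e -> pairing (frame_residual e v) eta = 0.
Proof.
move=> oe; rewrite /frame_residual pairingD !pairingN acm_eta_phi oppr0 add0r.
rewrite pairing_sum big1 ?oppr0 // => l _.
by rewrite pairingD !pairingZ acm_eta_phi (oe l).1 !mulr0 addr0.
Qed.

Lemma frame_residual_orth k (e : 'I_k -> 'rV[R]_(m.*2.+1)) v l :
  phi_orthonormal e ->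
  inner g (frame_residual e v) (e l) = 0 /\
  inner g (frame_residual e v) (e l *m phi) = 0.
Proof.
move=> oe; rewrite /frame_residual; move: (- (v *m phi *m phi)) => v'.
rewrite !innerDl !innerNl !inner_suml; split.
  rewrite (bigD1 l) //= big1 => [|l' /negPf nl]; rewrite innerDl !innerZl.
    rewrite ((oe l).2 l).1 eqxx [inner g (e l *m _) _]acm_g_sym ((oe l).2 l).2.
    by rewrite mulr1 mulr0 !addr0 subrr.
  rewrite ((oe l').2 l).1 nl [inner g (e l' *m _) _]acm_g_sym ((oe l).2 l').2.
  by rewrite !mulr0 addr0.
rewrite (bigD1 l) //= big1 => [|l' /negPf nl]; rewrite innerDl !innerZl;
  rewrite acm_g_phi_phi ?(oe _).1 //.
  by rewrite ((oe l).2 l).1 eqxx ((oe l).2 l).2 mulr1 mulr0 addr0 add0r subrr.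
by rewrite ((oe l').2 l).1 nl ((oe l').2 l).2 !mulr0 addr0.
Qed.

Lemma frame_residual_id k (e : 'I_k -> 'rV[R]_(m.*2.+1)) v :
  pairing v eta = 0 -> (forall l, inner g v (e l) = 0) ->
  (forall l, inner g v (e l *m phi) = 0) -> frame_residual e v = v.
Proof.
move=> v0 ve vp; rewrite /frame_residual acm_phi_sq_D // opprK.
by rewrite big1 ?subr0 // => l _; rewrite ve vp !scale0r addr0.
Qed.

(** If [B] has rows [xi], [e_k], [phi e_k], orthonormality reads [B g B^T = 1], whence
    [g^-1 = B^T B], a sum of rank-one matrices. *)
Lemma invmx_metric_frame (e : 'I_m -> 'rV[R]_(m.*2.+1)) : phi_orthonormal e ->
  invmx g = xi^T *m xi +
    \sum_k ((e k)^T *m e k + (e k *m phi)^T *m (e k *m phi)).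
Proof.
move=> oe; pose E := \matrix_l e l; pose F := \matrix_l (e l *m phi).
pose B := col_mx xi (col_mx E F).
have rE k : row k E = e k by exact: rowK.
have rF k : row k F = e k *m phi by exact: rowK.
have entry a b (X : 'M[R]_(a, m.*2.+1)) (Y : 'M[R]_(b, m.*2.+1)) k l :
    (X *m g *m Y^T) k l = inner g (row k X) (row l Y).
  by rewrite inner_row -!row_mul [RHS]mxE.
have BB : B *m (g *m B^T) = 1%:M.
  have -> : g *m B^T = row_mx (g *m xi^T) (row_mx (g *m E^T) (g *m F^T)).
    by rewrite /B !tr_col_mx !mul_mx_row.
  rewrite /B mul_col_row mul_mx_row mul_col_mx mul_col_row !mulmxA !scalar_mx_block.
  have row0 a (v : 'rV[R]_a) (k : 'I_1) : row k v = v.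
    by rewrite ord1; apply/rowP => j; rewrite !mxE.
  have xe k : inner g xi (e k) = 0 by rewrite acm_g_sym acm_g_xi (oe k).1.
  have xf k : inner g xi (e k *m phi) = 0 by rewrite acm_g_sym acm_g_xi acm_eta_phi.
  congr block_mx.
  - by apply/matrixP => k l; rewrite entry !row0 acm_g_xi acm_eta_xi // !ord1 mxE.
  - rewrite -row_mx0; congr row_mx; apply/matrixP => k l;
      by rewrite entry row0 mxE ?rE ?rF.
  - rewrite -col_mx0; congr col_mx; apply/matrixP => k l;
      by rewrite entry row0 mxE ?rE ?rF acm_g_sym.
  - congr block_mx; apply/matrixP => k l; rewrite entry ?rE ?rF.
    + by rewrite mxE ((oe k).2 l).1.
    + by rewrite mxE ((oe k).2 l).2.
    + by rewrite mxE acm_g_sym ((oe l).2 k).2.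
    + by rewrite mxE acm_g_phi_phi ?((oe k).2 l).1 // (oe k).1.
(* [B] is square only through the equation [1 + (m + m) = m.*2.+1], which does not hold by
   conversion. *)
have comm n n' (X : 'M[R]_(n, n')) (Y : 'M[R]_(n', n)) : n = n' ->
    X *m Y = 1%:M -> Y *m X = 1%:M.
  by move=> nn; case: n' / nn X Y => X Y; exact: mulmx1C.
have := comm _ _ _ _ _ BB; rewrite -mulmxA => /(_ (ltac:(lia))) gBB.
have gu := metric_unitmx (acm_g_metric A) ip.
have -> : invmx g = B^T *m B by rewrite -[RHS](mulKmx gu) gBB mulmx1.
rewrite /B !tr_col_mx !mul_row_col; congr (_ + _).
rewrite big_split /=; congr (_ + _); apply/matrixP => a b; rewrite mxE summxE;
  by apply: eq_bigr => k _; rewrite !mxE big_ord1 !mxE.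
Qed.

End AlmostContactAlgebra.

Section ChartSmoothness.
Context {R : realType} {d : nat} {M : manifold R d}.
Variables (U : set M) (oU : open U) (i : chart M).

Let oiU := @cmap_image_open R d M i U oU.

Lemma csmooth_cst {W : normedModType R} (w : W) : csmooth U i (fun=> w).
Proof. by move=> k; exact: Ck_on_cst. Qed.

Lemma csmooth_mulmx p q r (F : M -> 'M[R]_(p, q)) (G : M -> 'M[R]_(q, r)) :
  csmooth U i F -> csmooth U i G -> csmooth U i (fun x => F x *m G x).
Proof. by move=> sF sG k; exact: (Ck_on_mulmx oiU (sF k) (sG k)). Qed.

Lemma csmooth_addmx p q (F G : M -> 'M[R]_(p, q)) :
  csmooth U i F -> csmooth U i G -> csmooth U i (fun x => F x + G x).
Proof. by move=> sF sG k; exact: (Ck_onD_mx oiU (sF k) (sG k)). Qed.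

Lemma csmooth_scalemx p q (a : M -> R) (F : M -> 'M[R]_(p, q)) :
  csmooth U i a -> csmooth U i F -> csmooth U i (fun x => a x *: F x).
Proof. by move=> sa sF k; exact: (Ck_onZ_mx oiU (sa k) (sF k)). Qed.

Lemma csmooth_oppmx p q (F : M -> 'M[R]_(p, q)) :
  csmooth U i F -> csmooth U i (fun x => - F x).
Proof.
move=> sF; rewrite (_ : (fun x => - F x) = fun x => (-1 : R) *: F x).
  by apply: csmooth_scalemx => //; exact: csmooth_cst.
by apply/funext => x; rewrite scaleN1r.
Qed.

Lemma csmooth_summx p q (I : Type) (r : seq I) (F : I -> M -> 'M[R]_(p, q)) :
  (forall l, csmooth U i (F l)) -> csmooth U i (fun x => \sum_(l <- r) F l x).
Proof. by move=> sF k; exact: (Ck_on_sum_mx r oiU (fun l => sF l k)). Qed.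

Lemma csmooth_mxP p q (F : M -> 'M[R]_(p, q)) :
  csmooth U i F <-> forall a b, csmooth U i (fun x => F x a b).
Proof.
split=> [sF a b k|sF k]; first exact: (Ck_on_mxP k _ oiU).1 (sF k) a b.
by apply: (Ck_on_mxP k _ oiU).2 => a b; exact: sF.
Qed.

Lemma csmooth_inner (G : M -> 'M[R]_d) (u v : M -> 'rV[R]_d) :
  csmooth U i G -> csmooth U i u -> csmooth U i v ->
  csmooth U i (fun x => inner (G x) (u x) (v x)).
Proof.
move=> sG su sv.
have svT : csmooth U i (fun x => (v x)^T) by move=> k; exact: (Ck_on_trmx oiU (sv k)).
have := csmooth_mulmx (csmooth_mulmx su sG) svT.
by move/csmooth_mxP; exact.
Qed.

Lemma csmooth_inv (a : M -> R) : (forall p, U p -> cdom i p -> a p != 0) ->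
  csmooth U i a -> csmooth U i (fun x => (a x)^-1).
Proof.
move=> a0 sa k; apply: (Ck_onV oiU _ (sa k)) => _ [p [ip Up] <-].
by rewrite /= cmapK //; exact: a0.
Qed.

Lemma csmooth_sqrt (a : M -> R) : (forall p, U p -> cdom i p -> 0 < a p) ->
  csmooth U i a -> csmooth U i (fun x => Num.sqrt (a x)).
Proof.
move=> a0 sa k; apply: (Ck_on_sqrt oiU _ (sa k)) => _ [p [ip Up] <-].
by rewrite /= cmapK //; exact: a0.
Qed.

Lemma csmooth_gt0_open (a : M -> R) : U `<=` cdom i -> csmooth U i a ->
  open (U `&` [set p | 0 < a p]).
Proof.
move=> Ui sa; pose B := cmap i @` (cdom i `&` U) `&` [set x | 0 < a (cinv i x)].
have oB : open B.
  rewrite openE => x [Ax ax]; rewrite /interior; apply: filterI.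
    exact: open_nbhs_nbhs.
  have ca : {for x, continuous (a \o cinv i)} := Ck_on_continuous (sa 0%N) Ax.
  by apply: (cvgr_gt (a (cinv i x)) ca); exact: ax.
rewrite (_ : U `&` _ = cdom i `&` cmap i @^-1` B); first exact: cmap_preimage_open.
apply/seteqP; split=> p /=.
  by move=> [Up ap]; have ip := Ui _ Up; split=> //; split; [exists p|rewrite /= cmapK].
move=> [ip [[q [iq Uq] qp]]]; rewrite /= cmapK // => ap; split=> //.
by rewrite -(cmapK ip) -qp cmapK.
Qed.

End ChartSmoothness.

(** * Local frames and global sections of [D] *)

Section FramesAndExtensions.
Context {R : realType} {m : nat} {M : manifold R m.*2.+1} (A : acm_structure M).

Local Notation phi := (acm_phi A).
Local Notation xi := (acm_xi A).
Local Notation eta := (acm_eta A).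
Local Notation g := (acm_g A).

Lemma acm_phi_csmooth U i : csmooth U i (phi i).
Proof. by apply: (@csmooth_sub _ _ _ _ setT) => //; have [] := acm_phi_field A. Qed.

Lemma acm_g_csmooth U i : csmooth U i (g i).
Proof. by apply: (@csmooth_sub _ _ _ _ setT) => //; have [] := acm_g_metric A. Qed.

Lemma in_D_change i j p v : cdom i p -> cdom j p -> in_D A i p v ->
  in_D A j p (change i j p v).
Proof. by move=> ip jp; have [_ inv] := acm_eta_field A; rewrite /in_D inv. Qed.

(** The vector with constant components [v] is projected onto [D] at each point by [- phi^2],
    multiplied by a bump function normalized at [p], and extended by zero. *)
Lemma D_section_extension i p v : cdom i p -> in_D A i p v ->
  exists2 X, D_section_on A setT X & X i p = v.
Proof.
move=> ip Dv; have [psi [K [spsi psi0 cK Ki psiK]]] := exists_bump ip.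
pose Y q := (psi q / psi p) *: - (v *m phi i q *m phi i q).
exists (fun j q => if `[< cdom i q >] then change i j q (Y q) else 0); last first.
  by rewrite asboolT // change_id // /Y divff // scale1r acm_phi_sq_D // opprK.
split.
  apply: (vfield_from_chart_global cK Ki) => [|q iq nK]; last first.
    by rewrite /Y (psiK q iq nK) mul0r scale0r.
  have oi := cdom_open i; apply: csmooth_scalemx => //.
    move=> k; have := Ck_onM (@cmap_image_open _ _ _ i _ oi) (spsi k)
      (Ck_on_cst k _ ((psi p)^-1 : R)); exact.
  apply: csmooth_oppmx => //; apply: csmooth_mulmx => //; last exact: acm_phi_csmooth.
  apply: csmooth_mulmx => //; [exact: csmooth_cst|exact: acm_phi_csmooth].
move=> j q _ jq; case: asboolP => iq; last by rewrite /in_D pairing0.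
by apply: in_D_change => //; rewrite /in_D pairingZ pairingN acm_eta_phi // oppr0 mulr0.
Qed.

(** One Gram-Schmidt step at a time: the new vector is found at [p] by counting dimensions and its
    residual [W] is smooth. At [p] nothing is subtracted, so [W p = v] is nonzero, and [U] is shrunk
    to where [W] can be normalized. *)
Lemma partial_phi_frame i p k : cdom i p -> (k <= m)%N ->
  exists (U : set M) (E : 'I_k -> M -> 'rV[R]_(m.*2.+1)),
    [/\ open U, U p, U `<=` cdom i, forall l, csmooth U i (E l) &
        forall q, U q -> phi_orthonormal A i q (fun l => E l q)].
Proof.
move=> ip; elim: k => [|k IH] km.
  by exists (cdom i), (fun _ _ => 0); split=> //; [exact: cdom_open|case|move=> q _ []].
have [U [E [oU Up Ui sE oE]]] := IH (ltnW km).
have [v v0 [vD vE vF]] := acm_new_frame_vector A i p (fun l => E l p) km.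
pose W q := frame_residual A i q (fun l => E l q) v.
have Wp : W p = v by rewrite /W frame_residual_id.
have sphi := acm_phi_csmooth U i; have sg := acm_g_csmooth U i.
have sW : csmooth U i W.
  have svp : csmooth U i (fun q => - (v *m phi i q *m phi i q)).
    apply: csmooth_oppmx => //; apply: csmooth_mulmx => //; apply: csmooth_mulmx => //.
    exact: csmooth_cst.
  apply: csmooth_addmx => //; apply: csmooth_oppmx => //; apply: csmooth_summx => // l.
  have sF : csmooth U i (fun q => E l q *m phi i q) by exact: csmooth_mulmx.
  apply: csmooth_addmx => //; apply: csmooth_scalemx => //; exact: csmooth_inner.
have sWW : csmooth U i (fun q => inner (g i q) (W q) (W q)) by exact: csmooth_inner.
pose U' := U `&` [set q | 0 < inner (g i q) (W q) (W q)].
have oU' : open U' := csmooth_gt0_open oU Ui sWW.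
have U'U : U' `<=` U by move=> q [].
pose w q := (Num.sqrt (inner (g i q) (W q) (W q)))^-1 *: W q.
have sw : csmooth U' i w.
  have sWW' : csmooth U' i (fun q => inner (g i q) (W q) (W q)) := csmooth_sub U'U sWW.
  apply: csmooth_scalemx => //; last exact: csmooth_sub U'U sW.
  apply: csmooth_inv => //; first by move=> q [_ Wq] _; rewrite gt_eqF // sqrtr_gt0.
  by apply: csmooth_sqrt => // q [].
pose E' (l : 'I_k.+1) := if unlift ord_max l is Some l' then E l' else w.
exists U', E'; split=> //.
- by split=> //=; rewrite Wp; exact: acm_g_gt0.
- by move=> q /U'U /Ui.
- by move=> l; rewrite /E'; case: unlift => [l'|//]; exact: csmooth_sub U'U (sE l').
move=> q [Uq Wq]; have iq := Ui _ Uq; have oEq := oE _ Uq.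
have worth l : inner (g i q) (w q) (E l q) = 0 /\
    inner (g i q) (w q) (E l q *m phi i q) = 0.
  have [r1 r2] := frame_residual_orth iq v l oEq.
  by rewrite !innerZl r1 r2 mulr0.
move=> l; rewrite /E'; case: (unliftP ord_max l) => [l1|] ->.
  split=> [|l']; first exact: (oEq l1).1.
  case: (unliftP ord_max l') => [l2|] ->.
    have [e1 e2] := (oEq l1).2 l2; rewrite e1 e2; split=> //.
    by rewrite (inj_eq lift_inj).
  rewrite acm_g_sym // (worth l1).1 eq_sym (negPf (neq_lift _ _)); split=> //.
  have := acm_phi_skew A iq (E l1 q) (w q).
  by rewrite acm_g_sym // (worth l1).2 => /eqP; rewrite eq_sym oppr_eq0 => /eqP.
split=> [|l']; first by rewrite pairingZ frame_residual_D ?mulr0.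
case: (unliftP ord_max l') => [l2|] ->.
  by rewrite (worth l2).1 (worth l2).2 (negPf (neq_lift _ _)).
rewrite eqxx acm_phi_orth //; split=> //.
rewrite innerZl innerZr mulrA -invfM -expr2 sqr_sqrtr ?ltW // mulVf //.
by rewrite gt_eqF.
Qed.

Lemma exists_phi_frame i p : cdom i p ->
  exists (U : set M) (e : 'I_m -> vfamily M),
    [/\ open U, U p, phi_frame_on A U e & phi_orthonormal A i p (fun k => e k i p)].
Proof.
move=> ip; have [U [E [oU Up Ui sE oE]]] := partial_phi_frame ip (leqnn m).
exists U, (fun k j q => change i j q (E k q)); split=> //; last first.
  move=> k; rewrite change_id //; split=> [|l]; first exact: (oE p Up k).1.
  by rewrite change_id //; exact: (oE p Up k).2.
split=> [k|j q Uq jq k l].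
  split; first exact: vfield_from_chart.
  by move=> j q Uq jq; apply: in_D_change; [exact: Ui| |exact: (oE q Uq k).1].
have iq := Ui _ Uq; have [_ ginv _ _] := acm_g_metric A.
have [_ pinv] := acm_phi_field A.
have [ekl ekp] := (oE q Uq k).2 l.
rewrite /phi_vf !pinv // !ginv //; split=> //.
by rewrite acm_g_phi_phi //; exact: (oE q Uq k).1.
Qed.

End FramesAndExtensions.

(** * Differential calculus in charts *)

Section ProductRules.
Context {R : realType} {V : normedModType R}.

Lemma is_derive_mulmx p q r (F : V -> 'M[R]_(p, q)) (G : V -> 'M[R]_(q, r)) x v :
  derivable F x v -> derivable G x v ->
  is_derive x v (fun y => F y *m G y) ('D_v F x *m G x + F x *m 'D_v G x).
Proof.
move=> dF dG; have dFij := (derivable_mxP F x v).1 dF.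
have dGij := (derivable_mxP G x v).1 dG.
have der i j : is_derive x v (fun y => (F y *m G y) i j)
    (('D_v F x *m G x + F x *m 'D_v G x) i j).
  have -> : (fun y => (F y *m G y) i j) =
      \sum_l ((fun y => F y i l) * (fun y => G y l j)).
    by apply/funext => y; rewrite mxE fct_sumE.
  apply: (is_derive_eq (is_derive_sum (fun l =>
    is_deriveM (derivableP (dFij i l)) (derivableP (dGij l j))))).
  rewrite !mxE -big_split /=; apply: eq_bigr => l _.
  by rewrite (derive_mxE _ _ dF) (derive_mxE _ _ dG) addrC; congr (_ + _); exact: mulrC.
have dFG : derivable (fun y => F y *m G y) x v.
  by apply/derivable_mxP => i j; have [] := der i j.
split; first exact: dFG.
apply/matrixP => i j; apply: etrans (derive_mxE i j dFG) _.
by have [_] := der i j.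
Qed.

Lemma is_derive_trmx p q (F : V -> 'M[R]_(p, q)) x v : derivable F x v ->
  is_derive x v (fun y => (F y)^T) ('D_v F x)^T.
Proof.
move=> dF; have dFij := (derivable_mxP F x v).1 dF.
have e i j : (fun y => (F y)^T i j) = (fun y => F y j i).
  by apply/funext => y; rewrite mxE.
have dFT : derivable (fun y => (F y)^T) x v.
  by apply/derivable_mxP => i j; rewrite e; exact: dFij.
split; first exact: dFT.
apply/matrixP => i j; apply: etrans (derive_mxE i j dFT) _.
by rewrite e mxE (derive_mxE _ _ dF).
Qed.

Lemma is_derive_entry p q (F : V -> 'M[R]_(p, q)) x v i j : derivable F x v ->
  is_derive x v (fun y => F y i j) (('D_v F x) i j).
Proof.
move=> dF; rewrite (derive_mxE _ _ dF); apply: derivableP.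
exact: ((derivable_mxP F x v).1 dF).
Qed.

Lemma is_derive_scalemx p q (a : V -> R) (F : V -> 'M[R]_(p, q)) x v :
  derivable a x v -> derivable F x v ->
  is_derive x v (fun y => a y *: F y) ('D_v a x *: F x + a x *: 'D_v F x).
Proof.
move=> da dF; have der i j : is_derive x v (fun y => (a y *: F y) i j)
    (('D_v a x *: F x + a x *: 'D_v F x) i j).
  have -> : (fun y => (a y *: F y) i j) = a * (fun y => F y i j).
    by apply/funext => y; rewrite mxE.
  apply: (is_derive_eq (is_deriveM (derivableP da) (is_derive_entry i j dF))).
  by rewrite !mxE addrC; congr (_ + _); exact: mulrC.
have daF : derivable (fun y => a y *: F y) x v.
  by apply/derivable_mxP => i j; have [] := der i j.
split; first exact: daF.
apply/matrixP => i j; apply: etrans (derive_mxE i j daF) _.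
by have [_] := der i j.
Qed.

Lemma is_derive_pairing d (u : V -> 'rV[R]_d) (a : V -> 'cV[R]_d) x v :
  derivable u x v -> derivable a x v ->
  is_derive x v (fun y => pairing (u y) (a y))
    (pairing ('D_v u x) (a x) + pairing (u x) ('D_v a x)).
Proof.
move=> du da; have [dua eua] := is_derive_mulmx du da.
have [de ee] := is_derive_entry 0 0 dua.
by split; [exact: de|rewrite /pairing ee eua mxE].
Qed.

Lemma is_derive_inner d (G : V -> 'M[R]_d) (u w : V -> 'rV[R]_d) x v :
  derivable G x v -> derivable u x v -> derivable w x v ->
  is_derive x v (fun y => inner (G y) (u y) (w y))
    (inner ('D_v G x) (u x) (w x) + inner (G x) ('D_v u x) (w x) +
     inner (G x) (u x) ('D_v w x)).
Proof.
move=> dG du dw; have [duG euG] := is_derive_mulmx du dG.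
have [dwT ewT] := is_derive_trmx dw.
have [duw euw] := is_derive_mulmx duG dwT.
have [de ee] := is_derive_entry 0 0 duw.
split; first exact: de.
apply: etrans ee _; rewrite euw euG ewT mulmxDl [LHS]mxE.
by congr (_ + _); rewrite [LHS]mxE addrC.
Qed.

End ProductRules.

Section MapCalculus.
Context {R : realType} {d e : nat}.
Variables (Om : set 'rV[R]_d) (Om' : set 'rV[R]_e) (F : 'rV[R]_d -> 'rV[R]_e).
Hypotheses (oOm : open Om) (oOm' : open Om') (FOm : forall x, Om x -> Om' (F x)).
Hypothesis sF : smooth_on Om F.

Lemma smooth_derivable (c : nat) p q (B : set 'rV[R]_c)
    (G : 'rV[R]_c -> 'M[R]_(p, q)) x v :
  smooth_on B G -> B x -> derivable G x v.
Proof. by move=> sG Bx; exact: Ck_on_derivable (sG 1%N) Bx. Qed.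

Lemma hess_sym x u v : Om x -> 'D_u ('D_v F) x = 'D_v ('D_u F) x.
Proof. by move=> Ox; exact: derive_comm_mx oOm (sF 2%N) Ox. Qed.

Lemma hess_addl x u v w : Om x ->
  'D_(u + v) ('D_w F) x = 'D_u ('D_w F) x + 'D_v ('D_w F) x.
Proof. by move=> Ox; exact: (deriveD_dir u v oOm (Ck_on_partial w (sF 2%N)) Ox). Qed.

Lemma hess_scalel x (a : R) v w : Om x ->
  'D_(a *: v) ('D_w F) x = a *: 'D_v ('D_w F) x.
Proof. by move=> Ox; exact: (deriveZ_dir a v oOm (Ck_on_partial w (sF 2%N)) Ox). Qed.

(** Writing ['D_(w y) F y] as [w y *m partials F y] reduces this to the product rule; the case of a
    constant [w] identifies the first term. *)
Lemma derive_field (w : 'rV[R]_d -> 'rV[R]_d) x u : Om x -> derivable w x u ->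
  is_derive x u (fun y => 'D_(w y) F y) ('D_u ('D_(w x) F) x + 'D_('D_u w x) F x).
Proof.
move=> Ox dw; have near_Om : nbhs x Om by exact: open_nbhs_nbhs.
have FJ y v : Om y -> 'D_v F y = v *m partials F y.
  by move=> Oy; exact: derive_partials oOm (sF 1%N) Oy.
have dJ : derivable (partials F) x u.
  exact: Ck_on_derivable (Ck_on_partials oOm (sF 2%N)) Ox.
have near_eq (z : 'rV[R]_d -> 'rV[R]_d) :
    \forall y \near x, z y *m partials F y = 'D_(z y) F y.
  by apply: filterS near_Om => y Oy; rewrite FJ.
have [dwJ ewJ] := is_derive_mulmx dw dJ.
have hJ : 'D_u ('D_(w x) F) x = w x *m 'D_u (partials F) x.
  have [_ ez] := is_derive_mulmx (derivable_cst (w x) x u) dJ.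
  rewrite derive_cst mul0mx add0r in ez.
  apply: etrans ez; apply/esym; apply: near_eq_derive.
  exact: near_eq (cst (w x)).
apply: near_eq_is_derive (near_eq w) _.
by split; [exact: dwJ|rewrite ewJ hJ FJ // addrC].
Qed.

Lemma derive_along p q (G : 'rV[R]_e -> 'M[R]_(p, q)) x u : Om x -> smooth_on Om' G ->
  is_derive x u (G \o F) ('D_('D_u F x) G (F x)).
Proof.
move=> Ox sG; apply: (chain_rule_mx oOm' (sG 1%N)).
- exact: FOm.
- exact: Ck_on_continuous (sF 0%N) Ox.
- exact: smooth_derivable sF Ox.
Qed.

End MapCalculus.

Section ConnectionAlgebra.
Context {R : realType} {d : nat} {M : manifold R d}.
Variables (g : chart M -> M -> 'M[R]_d) (hg : riemannian_metric g).
Variables (i : chart M) (p : M) (ip : cdom i p).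
Implicit Types u v w : 'rV[R]_d.

Lemma csmooth_derivable q r U (F : M -> 'M[R]_(q, r)) v : csmooth U i F -> U p ->
  derivable (F \o cinv i) (cmap i p) v.
Proof.
by move=> sF Up; apply: Ck_on_derivable (sF 1%N) _; exists p.
Qed.

Lemma GammaDl u v w : Gamma g i p (u + v) w = Gamma g i p u w + Gamma g i p v w.
Proof.
apply/rowP => c; rewrite !mxE -big_split /=; apply: eq_bigr => a _.
by rewrite -big_split /=; apply: eq_bigr => b _; rewrite mxE !mulrDl.
Qed.

Lemma GammaZl (s : R) u v : Gamma g i p (s *: u) v = s *: Gamma g i p u v.
Proof.
apply/rowP => c; rewrite !mxE mulr_sumr; apply: eq_bigr => a _.
by rewrite mulr_sumr; apply: eq_bigr => b _; rewrite mxE !mulrA.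
Qed.

(** Torsion-freeness for constant fields, whose bracket vanishes. *)
Lemma Gamma_sym u v : Gamma g i p u v = Gamma g i p v u.
Proof.
have := nabla_torsion_free hg ip (cst u) (cst v).
have c0 (w : 'rV[R]_d) z : cderiv i (cst w) p z = 0 by exact: derive_cst.
by rewrite /nabla /bracket !c0 subrr !add0r => /eqP; rewrite subr_eq0 => /eqP.
Qed.

Lemma GammaZr (s : R) u v : Gamma g i p u (s *: v) = s *: Gamma g i p u v.
Proof. by rewrite Gamma_sym GammaZl Gamma_sym. Qed.

Lemma inner_metric_derive u v w :
  inner (cderiv i (g i) p u) v w =
  inner (g i p) (Gamma g i p u v) w + inner (g i p) (Gamma g i p u w) v.
Proof.
(* [K] is the matrix of the bilinear form [g (Gamma u x) y]; contracted with [u], [nabla_metric]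
   says that the derivative of [g] is [K + K^T]. *)
pose K := \matrix_(b, c) \sum_a u 0 a * \sum_l christoffel g i p a b l * g i p l c.
have GK x : Gamma g i p u x *m g i p = x *m K.
  apply/rowP => c; rewrite !mxE.
  transitivity (\sum_l \sum_b \sum_a
      x 0 b * (u 0 a * (christoffel g i p a b l * g i p l c))).
    apply: eq_bigr => l _; rewrite mxE exchange_big mulr_suml; apply: eq_bigr => b _.
    by rewrite mulr_suml; apply: eq_bigr => a _; ring.
  rewrite exchange_big; apply: eq_bigr => b _; rewrite mxE exchange_big mulr_sumr.
  by apply: eq_bigr => a _; rewrite !mulr_sumr.
have sg : csmooth setT i (g i) by have [] := hg.
have Op : (cmap i @` (cdom i `&` setT)) (cmap i p) by exists p.
have oO : open (cmap i @` (cdom i `&` setT)) by apply: cmap_image_open; exact: openT.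
have dK : cderiv i (g i) p u = K + K^T.
  apply/matrixP => b c; rewrite /cderiv (derive_partial_mx u oO (sg 1%N) Op) summxE !mxE.
  rewrite -big_split /=; apply: eq_bigr => a _; rewrite mxE -mulrDr.
  rewrite -(nabla_metric hg ip) /dmetric /cderiv.
  by congr (_ * _); apply: derive_mxE; exact: csmooth_derivable sg _.
rewrite dK /inner mulmxDr mulmxDl mxE !GK; congr (_ + _).
by rewrite -[in RHS](trmxK (w *m K *m v^T)) [RHS]mxE !trmx_mul trmxK mulmxA.
Qed.

End ConnectionAlgebra.

(** * Covariant derivative of [phi] and exterior derivative of [eta] *)

Section AlmostContactGeometry.
Context {R : realType} {m : nat} {M : manifold R m.*2.+1} (A : acm_structure M).
Variables (i : chart M) (p : M) (ip : cdom i p).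
Implicit Types u v w : 'rV[R]_(m.*2.+1).

Local Notation phi := (acm_phi A).
Local Notation xi := (acm_xi A).
Local Notation eta := (acm_eta A).
Local Notation g := (acm_g A).
Local Notation Gam := (Gamma g i p).

(* [(nabla_u phi) v], which depends only on the values of [u] and [v] at [p]. *)
Definition phi_covariant u v :=
  v *m cderiv i (phi i) p u + Gam u (v *m phi i p) - Gam u v *m phi i p.

Lemma nabla_endo_phi U X Y : csmooth U i Y -> U p ->
  nabla_endo g i X (phi i) Y p = phi_covariant (X p) (Y p).
Proof.
move=> sY Up; rewrite /nabla_endo /nabla /phi_covariant.
have dY := csmooth_derivable (v := X p) ip sY Up.
have dphi := csmooth_derivable (v := X p) ip (acm_phi_csmooth A U i) Up.
have -> : cderiv i (fun q => Y q *m phi i q) p (X p) =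
    cderiv i Y p (X p) *m phi i p + Y p *m cderiv i (phi i) p (X p).
  have [_ e] := is_derive_mulmx dY dphi; apply: etrans e _.
  by rewrite /= cmapK.
have cancel (a b c : 'rV[R]_(m.*2.+1)) : a + b + c - a = b + c.
  by rewrite -[a + b + c]addrA addrAC subrr add0r.
by rewrite mulmxDl opprD addrA cancel.
Qed.

Lemma S_tensor_phi U X Y : csmooth U i X -> csmooth U i Y -> U p ->
  S_tensor A i X Y p = phi_covariant (X p) (Y p) - phi_covariant (Y p) (X p).
Proof.
by move=> sX sY Up; rewrite /S_tensor (nabla_endo_phi _ sY Up) (nabla_endo_phi _ sX Up).
Qed.

Lemma S_tensor_phi_vf U (X : vfamily M) : open U -> csmooth U i (X i) -> U p ->
  S_tensor A i (phi_vf A X i) (X i) p =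
  phi_covariant (X i p *m phi i p) (X i p) - phi_covariant (X i p) (X i p *m phi i p).
Proof.
move=> oU sX; apply: S_tensor_phi => //.
by apply: csmooth_mulmx => //; exact: acm_phi_csmooth.
Qed.

(** Both sides are tensorial, so a global extension of [v] turns the condition on sections into one
    on vectors. *)
Lemma quasi_symplectic_at v : quasi_symplectic A -> in_D A i p v ->
  phi_covariant (v *m phi i p) v - phi_covariant v (v *m phi i p) = 0.
Proof.
move=> qs Dv; have [X DX <-] := D_section_extension ip Dv.
have [[sX _] _] := DX.
by rewrite -(S_tensor_phi_vf openT (sX i)) //; exact: qs.
Qed.

(** [d eta], without a factor one half, evaluated on [u] and [v] extended with constant
    components. *)
Definition deta u v :=
  pairing v (cderiv i (eta i) p u) - pairing u (cderiv i (eta i) p v).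

Lemma acm_xi_csmooth U : csmooth U i (xi i).
Proof. by apply: (@csmooth_sub _ _ _ _ setT) => //; have [] := acm_xi_field A. Qed.

Lemma acm_eta_csmooth U : csmooth U i (eta i).
Proof. by apply: (@csmooth_sub _ _ _ _ setT) => //; have [] := acm_eta_field A. Qed.

Lemma near_chart (P : 'rV[R]_(m.*2.+1) -> Prop) U : open U -> U p ->
  (forall q, cdom i q -> U q -> P (cmap i q)) -> \forall x \near cmap i p, P x.
Proof.
move=> oU Up H; have : nbhs (cmap i p) (cmap i @` (cdom i `&` U)).
  by apply: open_nbhs_nbhs; split; [exact: cmap_image_open|exists p].
by apply: filterS => _ [q [iq Uq] <-]; exact: H.
Qed.

(** Differentiating [eta X = 0] and [eta Y = 0] moves the derivatives in the bracket onto [eta]. The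
    involutivity conditions thereby become conditions on [d eta] at [p]. *)
Lemma deta_bracket U X Y : open U -> U p -> csmooth U i X -> csmooth U i Y ->
  (forall q, cdom i q -> U q -> in_D A i q (X q)) ->
  (forall q, cdom i q -> U q -> in_D A i q (Y q)) ->
  pairing (bracket i X Y p) (eta i p) = - deta (X p) (Y p).
Proof.
move=> oU Up sX sY DX DY.
have dD Z u : csmooth U i Z -> (forall q, cdom i q -> U q -> in_D A i q (Z q)) ->
    pairing (cderiv i Z p u) (eta i p) = - pairing (Z p) (cderiv i (eta i) p u).
  move=> sZ DZ.
  have dZ := csmooth_derivable (v := u) ip sZ Up.
  have deta := csmooth_derivable (v := u) ip (acm_eta_csmooth U) Up.
  have [_] := is_derive_pairing dZ deta.
  rewrite (_ : 'D_u _ _ = 0) /= ?cmapK //.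
    by move/eqP; rewrite eq_sym addr_eq0 => /eqP.
  rewrite -[RHS](derive_cst (0 : R) (cmap i p) u); apply: near_eq_derive.
  by apply: (near_chart oU Up) => q iq Uq; rewrite cmapK //; exact: DZ.
by rewrite /bracket pairingD pairingN !dD // opprK /deta opprB addrC.
Qed.

(* Contraction of [d eta] with [xi]. *)
Lemma eta_xi_closed v : geodesic_xi A ->
  pairing v (cderiv i (eta i) p (xi i p)) = pairing (xi i p) (cderiv i (eta i) p v).
Proof.
move=> geo; have hg := acm_g_metric A.
have sxi := acm_xi_csmooth setT; have sg := acm_g_csmooth A setT i.
have Tp : [set: M] p by [].
have dxi u := csmooth_derivable (v := u) ip sxi Tp.
have dg u := csmooth_derivable (v := u) ip sg Tp.
(* As [eta = g (_, xi)] and [g] is parallel, [d eta (xi, v) = g (nabla_xi xi, v) - g (nabla_v xi,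
   xi)]: the first term vanishes by [geo], the second because [xi] has unit length. *)
have eta_g w u : pairing w (cderiv i (eta i) p u) =
    inner (cderiv i (g i) p u) w (xi i p) + inner (g i p) w (cderiv i (xi i) p u).
  have deta := csmooth_derivable (v := u) ip (acm_eta_csmooth setT) Tp.
  have [_ e1] := is_derive_pairing (derivable_cst w (cmap i p) u) deta.
  have [_ e2] := is_derive_inner (dg u) (derivable_cst w (cmap i p) u) (dxi u).
  move: e1 e2; rewrite derive_cst pairing0 inner0l add0r addr0 /= !cmapK // => <- <-.
  apply: near_eq_derive; apply: (near_chart openT Tp) => q iq _.
  by rewrite /= cmapK // acm_g_xi.
have unit u : inner (cderiv i (g i) p u) (xi i p) (xi i p) +
    2 * inner (g i p) (xi i p) (cderiv i (xi i) p u) = 0.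
  have [_] := is_derive_inner (dg u) (dxi u) (dxi u).
  rewrite /= !cmapK // => e.
  apply: etrans (_ : _ = 'D_u (fun y => inner ((g i \o cinv i) y)
    ((xi i \o cinv i) y) ((xi i \o cinv i) y)) (cmap i p)) _.
    apply: etrans (esym e); rewrite [inner _ ('D_u _ _) _]acm_g_sym //.
    by rewrite -addrA mulr_natl mulr2n.
  rewrite -[RHS](derive_cst (1 : R) (cmap i p) u); apply: near_eq_derive.
  apply: (near_chart openT Tp) => q iq _.
  by rewrite /= cmapK // acm_g_xi // acm_eta_xi.
have dxx : cderiv i (xi i) p (xi i p) = - Gam (xi i p) (xi i p).
  by have /eqP := geo i p ip; rewrite /nabla addr_eq0 => /eqP.
rewrite !eta_g dxx innerNr.
have := unit v; rewrite !(inner_metric_derive hg ip).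
rewrite [inner _ v (Gam _ _)]acm_g_sym // (Gamma_sym hg ip v).
lra.
Qed.

Lemma noninvolutive_at : (0 < m)%N ->
  non_semi_phi_involutive A \/ non_phi_involutive A ->
  exists2 u, in_D A i p u & deta u (u *m phi i p) != 0.
Proof.
move=> m0 [ns|np].
  have [U [e [oU Up fe _]]] := exists_phi_frame A ip; have [De _] := fe.
  (* If [d eta (u, phi u)] vanished for every [u] in [D], so would [eta] of each bracket in the sum
     over the frame. *)
  apply: contrapT => none; apply: (ns p U e oU Up fe i ip).
  rewrite /in_D pairing_sum big1 // => k _; have [[se _] Dk] := De k.
  rewrite (deta_bracket oU Up (se i)).
  - apply/eqP; rewrite oppr_eq0; apply: contra_notT none => nz.
    by exists (e k i p) => //; exact: Dk.
  - by apply: csmooth_mulmx => //; exact: acm_phi_csmooth.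
  - by move=> q iq Uq; exact: Dk.
  - by move=> q iq Uq; rewrite /in_D acm_eta_phi.
(* With an empty family this is just a nonzero vector of [D], which exists because [0 < m]. *)
have [v v0 [Dv _ _]] := acm_new_frame_vector A i p (fun k : 'I_0 => 0) m0.
have [X DX Xv] := D_section_extension ip Dv; have [[sX _] DXp] := DX.
exists v => //; apply/eqP => z; apply: (np p X DX i ip); first by rewrite Xv.
rewrite /in_D (deta_bracket openT _ (sX i)) //.
- by rewrite /phi_vf Xv z oppr0.
- by apply: csmooth_mulmx; [exact: openT|exact: sX|exact: acm_phi_csmooth].
- by move=> q iq Uq; exact: DXp.
- by move=> q iq Uq; rewrite /in_D acm_eta_phi.
Qed.

End AlmostContactGeometry.

(** * Holomorphic maps *)

(** With [invmx_metric_frame], this turns the trace over the coordinate basis in [tension] into a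
    sum over an orthonormal frame. *)
Lemma bilinear_rank_one (R : realType) (d : nat) (W : lmodType R)
    (beta : 'rV[R]_d -> 'rV[R]_d -> W) (u : 'rV[R]_d) :
  (forall x y z, beta (x + y) z = beta x z + beta y z) ->
  (forall a x y, beta (a *: x) y = a *: beta x y) ->
  (forall x y, beta x y = beta y x) ->
  \sum_k \sum_l (u^T *m u) k l *: beta (delta_mx 0 k) (delta_mx 0 l) = beta u u.
Proof.
move=> addl scalel sym.
have expand y : beta u y = \sum_k u 0 k *: beta (delta_mx 0 k) y.
  have b0 : beta 0 y = 0 by rewrite -(scale0r 0) scalel scale0r.
  rewrite {1}[u]row_sum_delta (big_morph (fun x => beta x y) (fun x z => addl x z y) b0).
  by apply: eq_bigr => k _.
rewrite [RHS]expand; apply: eq_bigr => k _.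
rewrite sym expand scaler_sumr; apply: eq_bigr => l _.
by rewrite mxE big_ord1 mxE scalerA sym.
Qed.

(* Locked so that conversion never compares iterated derivatives. *)
HB.lock Definition second_derivative (R : realType) (d : nat) (W : normedModType R)
  (F : 'rV[R]_d -> W) (x u v : 'rV[R]_d) : W := 'D_u ('D_v F) x.

Section HolomorphicMap.
Context {R : realType} {m n : nat}.
Context {M : manifold R m.*2.+1} {N : manifold R n.*2.+1}.
Variables (A : acm_structure M) (B : acm_structure N) (f : M -> N) (c : R).
Hypotheses (f_smooth : smooth_map f) (c2 : c * c = 1).
Hypothesis f_holo : sign_holomorphic A B c f.
Variables (i : chart M) (b : chart N).

Local Notation U := (f @^-1` cdom b).
Local Notation Om := (cmap i @` (cdom i `&` U)).
Local Notation Om' := (cmap b @` (cdom b `&` setT)).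
Local Notation F := ((cmap b \o f) \o cinv i).
Local Notation df := (tangent_map f i b).
Local Notation phi := (acm_phi A).
Local Notation xi := (acm_xi A).
Local Notation eta := (acm_eta A).
Local Notation g := (acm_g A).
Local Notation phi' := (acm_phi B).
Local Notation gam := (acm_xi B).
Local Notation sig := (acm_eta B).
Local Notation h := (acm_g B).

Let oU : open U.
Proof.
have [cf _] := f_smooth; apply: open_comp; last exact: cdom_open.
by move=> x _; exact: cf.
Qed.

Let oOm : open Om.
Proof. exact: cmap_image_open. Qed.

Let oOm' : open Om'.
Proof. by apply: cmap_image_open; exact: openT. Qed.

Let FOm x : Om x -> Om' (F x).
Proof. by move=> [q [iq Uq] <-]; exists (f q) => //=; rewrite cmapK. Qed.

Let sF : smooth_on Om F.
Proof. by have [_] := f_smooth; exact. Qed.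

Let c0 : c != 0.
Proof. by apply: contra_eq_neq c2 => ->; rewrite mul0r eq_sym oner_eq0. Qed.

Local Notation hess q u v := (second_derivative F (cmap i q) u v).

(** Pointwise form of the second fundamental form; [tension] evaluates the latter on constant fields
    only, so [sffE] is all the comparison required. *)
Definition sff q u v :=
  hess q u v + Gamma h b (f q) (df q u) (df q v) - df q (Gamma g i q u v).

(* The function [lam] such that [f_* xi = lam gamma]. *)
Definition conformal_factor q := pairing (df q (xi i q)) (sig b (f q)).

(** * Second fundamental form of a holomorphic map *)

Section SecondFundamentalForm.
Variables (p : M) (ip : cdom i p) (bp : cdom b (f p)).
Implicit Types u v w : 'rV[R]_(m.*2.+1).

Let Op : Om (cmap i p). Proof. by exists p. Qed.

Lemma dfD u v : df p (u + v) = df p u + df p v.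
Proof. exact: (deriveD_dir u v oOm (sF 1%N) Op). Qed.

Lemma dfZ (a : R) v : df p (a *: v) = a *: df p v.
Proof. exact: (deriveZ_dir a v oOm (sF 1%N) Op). Qed.

Lemma dfN v : df p (- v) = - df p v.
Proof. by rewrite -scaleN1r dfZ scaleN1r. Qed.

Lemma df_phi v : df p (v *m phi i p) = c *: (df p v *m phi' b (f p)).
Proof. exact: f_holo. Qed.

Lemma sffE u v :
  second_fundamental_form f g h i b (cst u) (cst v) p = sff p u v.
Proof.
have e1 : cderiv i (fun q => df q v) p u = hess p u v.
  rewrite second_derivative.unlock; apply: near_eq_derive.
  apply: (near_chart ip oU bp) => q iq Uq.
  by rewrite /= cmapK.
have e2 : nabla g i (cst u) (cst v) p = Gamma g i p u v.
  have e : cderiv i (cst v) p u = 0 by exact: derive_cst.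
  by rewrite /nabla e add0r.
by rewrite /second_fundamental_form /nabla_along e2 /sff -e1.
Qed.

Lemma sff_sym u v : sff p u v = sff p v u.
Proof.
rewrite /sff (Gamma_sym (acm_g_metric B) bp) (Gamma_sym (acm_g_metric A) ip).
have -> // : hess p u v = hess p v u.
by rewrite second_derivative.unlock; exact: (hess_sym oOm sF u v Op).
Qed.

Lemma sffDl u v w : sff p (u + v) w = sff p u w + sff p v w.
Proof.
rewrite /sff GammaDl !dfD GammaDl.
have -> : hess p (u + v) w = hess p u w + hess p v w.
  by rewrite second_derivative.unlock; exact: (hess_addl oOm sF u v w Op).
move: (hess p u w) (hess p v w) (df p (Gamma g i p u w)) (df p (Gamma g i p v w)).
move: (Gamma h b _ (df p u) _) (Gamma h b _ (df p v) _) => x1 x2 x3 x4 x5 x6.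
by apply/rowP => j; rewrite !mxE; ring.
Qed.

Lemma sffZl (a : R) u w : sff p (a *: u) w = a *: sff p u w.
Proof.
rewrite /sff GammaZl !dfZ GammaZl.
have -> : hess p (a *: u) w = a *: hess p u w.
  by rewrite second_derivative.unlock; exact: (hess_scalel oOm sF a u w Op).
by rewrite scalerBr scalerDr.
Qed.

Lemma derive_df (w : 'rV[R]_(m.*2.+1) -> 'rV[R]_(m.*2.+1)) u :
  derivable w (cmap i p) u ->
  is_derive (cmap i p) u (fun y => 'D_(w y) F y)
    (hess p u (w (cmap i p)) + df p ('D_u w (cmap i p))).
Proof. by rewrite second_derivative.unlock; exact: (derive_field oOm sF Op). Qed.

Lemma derive_pullback q r (G : N -> 'M[R]_(q, r)) u : csmooth setT b G ->
  is_derive (cmap i p) u ((G \o cinv b) \o F) (cderiv b G (f p) (df p u)).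
Proof.
move=> sG; have [dG eG] := derive_along oOm' FOm sF u Op sG.
by split; [exact: dG|rewrite eG /= cmapK].
Qed.

Lemma sff_phi u v : sff p u (v *m phi i p) =
  c *: phi_covariant B b (f p) (df p u) (df p v) - df p (phi_covariant A i p u v) +
  c *: (sff p u v *m phi' b (f p)).
Proof.
have dphi := csmooth_derivable (v := u) ip (acm_phi_csmooth A setT i) I.
have [dw ew] := is_derive_mulmx (derivable_cst v (cmap i p) u) dphi.
have [_ el] := derive_df dw.
have dFv : derivable ('D_v F) (cmap i p) u.
  exact: Ck_on_derivable (Ck_on_partial v (sF 2%N)) Op.
have [dP eP] := derive_pullback u (acm_phi_csmooth B setT b).
have [dr er] := is_derive_mulmx dFv dP.
have [_ er'] := is_derive_scalemx (derivable_cst c (cmap i p) u) dr.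
(* Holomorphy holds at all points near [p], for the vector with constant components [v], so it may
   be differentiated. *)
have lr : 'D_u (fun y => 'D_(v *m (phi i \o cinv i) y) F y) (cmap i p) =
    'D_u (fun y => c *: ('D_v F y *m ((phi' b \o cinv b) \o F) y)) (cmap i p).
  apply: near_eq_derive; apply: (near_chart ip oU bp) => q iq Uq.
  by rewrite /= !cmapK //; exact: f_holo.
have := etrans (esym el) (etrans lr er').
rewrite ew er eP derive_cst mul0mx !add0r derive_cst scale0r add0r /= !cmapK // => E.
have {}E : hess p u (v *m phi i p) + df p (v *m cderiv i (phi i) p u) =
    c *: (hess p u v *m phi' b (f p) + df p v *m cderiv b (phi' b) (f p) (df p u)).
  by apply: etrans E _; rewrite second_derivative.unlock.
rewrite /sff /phi_covariant df_phi.
have -> : hess p u (v *m phi i p) = c *: (hess p u v *m phi' b (f p) +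
   df p v *m cderiv b (phi' b) (f p) (df p u)) - df p (v *m cderiv i (phi i) p u).
  by rewrite -E addrK.
rewrite (GammaZr (acm_g_metric B) bp) !dfD !dfN df_phi.
rewrite !mulmxDl !mulNmx !scalerDr !scalerN.
(* The terms become opaque vectors, which leaves a linear identity between entries. *)
move: (c *: (hess _ _ _ *m _)) (c *: (_ *m cderiv _ _ _ _)) => a1 a2.
move: (df p (v *m _)) (c *: Gamma _ _ _ _ (_ *m _)) => a3 a4.
move: (df p (Gamma _ _ _ _ _)) (c *: (Gamma _ _ _ _ _ *m _)) => a5 a6.
move: (c *: (df p (Gamma _ _ _ _ _) *m _)) => a7.
by apply/rowP => j; rewrite !mxE; ring.
Qed.

Lemma phi_covariantZl (a : R) (x y : 'rV[R]_(n.*2.+1)) :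
  phi_covariant B b (f p) (a *: x) y = a *: phi_covariant B b (f p) x y.
Proof.
rewrite /phi_covariant !GammaZl.
have -> : cderiv b (phi' b) (f p) (a *: x) = a *: cderiv b (phi' b) (f p) x.
  apply: (deriveZ_dir a x oOm' (acm_phi_csmooth B setT b 1%N)).
  by exists (f p).
by rewrite scalerBr scalerDr -scalemxAr -scalemxAl.
Qed.

Lemma phi_covariantZr (a : R) (x y : 'rV[R]_(n.*2.+1)) :
  phi_covariant B b (f p) x (a *: y) = a *: phi_covariant B b (f p) x y.
Proof.
rewrite /phi_covariant -!scalemxAl !(GammaZr (acm_g_metric B) bp).
by rewrite scalerBr scalerDr -scalemxAl.
Qed.

(** A vector of [D] is [- phi (phi v)], so its image lies in the range of [phi'], on which [sigma]
    vanishes. *)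
Lemma df_in_D v : in_D A i p v -> in_D B b (f p) (df p v).
Proof.
move=> Dv; rewrite /in_D -[v]opprK -(acm_phi_sq_D ip Dv) dfN df_phi.
by rewrite pairingN pairingZ acm_eta_phi // mulr0 oppr0.
Qed.

(** Holomorphy and [phi xi = 0] put [f_* xi] in the kernel of [phi'], which the formula for [phi'^2]
    shows to be spanned by [gamma]. *)
Lemma df_xi : df p (xi i p) = conformal_factor p *: gam b (f p).
Proof.
have z : df p (xi i p) *m phi' b (f p) = 0.
  have := df_phi (xi i p); rewrite acm_xi_phi // -(scale0r 0) dfZ scale0r.
  by move/esym/eqP; rewrite scaler_eq0 (negPf c0) /= => /eqP.
have := acm_phi_sq B (df p (xi i p)) bp; rewrite z mul0mx => /esym/eqP.
by rewrite addrC subr_eq0 => /eqP.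
Qed.

Lemma pullback_eta v :
  pairing (df p v) (sig b (f p)) = conformal_factor p * pairing v (eta i p).
Proof.
have -> : v = pairing v (eta i p) *: xi i p - v *m phi i p *m phi i p.
  by rewrite acm_phi_sq // opprD opprK addrCA subrr addr0.
rewrite dfD dfZ dfN df_phi !pairingD !pairingN !pairingZ acm_eta_phi //.
by rewrite acm_eta_phi // acm_eta_xi // mulr0 oppr0 !addr0 mulr1 mulrC.
Qed.

(* The identity [sff_phi] at [(phi u, u)] and [(u, phi u)]. *)
Lemma sff_D u : quasi_symplectic B -> in_D A i p u ->
  sff p u u + sff p (u *m phi i p) (u *m phi i p) =
  - df p (phi_covariant A i p (u *m phi i p) u - phi_covariant A i p u (u *m phi i p)).
Proof.
move=> qs Du; have e1 := sff_phi (u *m phi i p) u.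
have := sff_phi u (u *m phi i p); rewrite (acm_phi_sq_D ip Du).
have -> : sff p u (- u) = - sff p u u by rewrite sff_sym -scaleN1r sffZl scaleN1r.
move=> e2; rewrite -[sff p u u]opprK e2 e1 (sff_sym (u *m _) u).
have := quasi_symplectic_at bp qs (df_in_D Du).
move/eqP; rewrite subr_eq0 => /eqP e3.
rewrite df_phi phi_covariantZl phi_covariantZr e3.
move: (phi_covariant A i p (u *m phi i p) u) (phi_covariant A i p u (u *m phi i p)).
move=> t1 t2; rewrite dfD dfN; move: (df p t1) (df p t2) => y1 y2.
move: (c *: (c *: _)) (c *: (sff _ _ _ *m _)) => x z.
by apply/rowP => j; rewrite !mxE; ring.
Qed.

End SecondFundamentalForm.

Local Notation lam := conformal_factor.

Definition conformal_rate q := cderiv i lam q (xi i q).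

Lemma conformal_factor_csmooth : csmooth U i lam.
Proof.
move=> k; have sJ := Ck_on_partials oOm (sF k.+1).
have sX := Ck_on_mulmx oOm (acm_xi_csmooth A i U k) sJ.
have sS := Ck_on_comp_mx oOm oOm' FOm (sF k) (acm_eta_csmooth B b setT k).
have /(Ck_on_mxP k _ oOm)/(_ 0 0) := Ck_on_mulmx oOm sX sS.
apply: (Ck_on_eq oOm) => x; rewrite inE => -[q [iq Uq] <-].
have Oq : Om (cmap i q) by exists q.
rewrite /= cmapK // cmapK // /lam /pairing /tangent_map /cderiv.
by rewrite (derive_partials (xi i q) oOm (sF 1%N) Oq).
Qed.

Lemma conformal_rate_csmooth : csmooth U i conformal_rate.
Proof.
move=> k; have sl := conformal_factor_csmooth.
have /(Ck_on_mxP k _ oOm) sxi := acm_xi_csmooth A i U k.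
have := Ck_on_sum (index_enum 'I_(m.*2.+1)) oOm
  (fun j => Ck_onM oOm (sxi 0 j) (Ck_on_partial (delta_mx 0 j) (sl k.+1))).
apply: (Ck_on_eq oOm) => x; rewrite inE => -[q [iq Uq] <-].
have Oq : Om (cmap i q) by exists q.
rewrite /= cmapK // /conformal_rate /cderiv.
by rewrite (C1_derive_partial _ (Ck_on_C1_at oOm (sl 1%N) Oq)).
Qed.

Section ConformalFactor.
Variables (p : M) (ip : cdom i p) (bp : cdom b (f p)).
Implicit Types u v w : 'rV[R]_(m.*2.+1).

Let Op : Om (cmap i p). Proof. by exists p. Qed.

Lemma derivable_scalar (a : M -> R) u : csmooth U i a ->
  derivable (a \o cinv i) (cmap i p) u.
Proof. by move=> sa; exact: (Ck_on_derivable (sa 1%N) Op). Qed.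

Lemma pullback_eta_derive u v :
  pairing (hess p u v) (sig b (f p)) +
  pairing (df p v) (cderiv b (sig b) (f p) (df p u)) =
  cderiv i lam p u * pairing v (eta i p) + lam p * pairing v (cderiv i (eta i) p u).
Proof.
have dFv : derivable ('D_v F) (cmap i p) u.
  exact: (Ck_on_derivable (Ck_on_partial v (sF 2%N)) Op).
have [dP eP] := derive_pullback ip bp u (acm_eta_csmooth B b setT).
have [_ e1] := is_derive_pairing dFv dP.
have deta := csmooth_derivable (v := u) ip (acm_eta_csmooth A i setT) I.
have [dp ep] := is_derive_pairing (derivable_cst v (cmap i p) u) deta.
have dl := derivable_scalar (u := u) conformal_factor_csmooth.
have e2 := deriveM dl dp.
have l : 'D_u (fun y => pairing ('D_v F y) (((sig b \o cinv b) \o F) y)) (cmap i p) =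
    'D_u ((lam \o cinv i) * (fun y => pairing (cst v y) ((eta i \o cinv i) y)))
      (cmap i p).
  apply: near_eq_derive; apply: (near_chart ip oU bp) => q iq Uq.
  rewrite mulrfctE /= !cmapK //; exact: (pullback_eta iq Uq v).
have := etrans (esym e1) (etrans l e2).
rewrite ep eP derive_cst pairing0 add0r /= (cmapK ip) (cmapK bp) => E.
rewrite second_derivative.unlock; apply: etrans E _; move=> {e1 e2 l ep eP}.
by rewrite addrC; congr (_ + _); exact: mulrC.
Qed.

(* [d (f^* sigma) = d lam /\ eta + lam d eta] evaluated on [u] and [xi]. *)
Lemma conformal_factor_derive u : geodesic_xi A -> geodesic_xi B ->
  cderiv i lam p u = conformal_rate p * pairing u (eta i p).
Proof.
move=> gA gB.
have Op' : Om' (cmap b (f p)) by exists (f p).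
have lin : cderiv b (sig b) (f p) (lam p *: gam b (f p)) =
    lam p *: cderiv b (sig b) (f p) (gam b (f p)).
  exact: (deriveZ_dir (lam p) (gam b (f p)) oOm' (acm_eta_csmooth B b setT 1%N) Op').
have d2 : pairing (df p (xi i p)) (cderiv b (sig b) (f p) (df p u)) =
    pairing (df p u) (cderiv b (sig b) (f p) (df p (xi i p))).
  rewrite (df_xi ip bp).
  apply: etrans (pairingZ _ _ _) _.
  apply: etrans (congr1 (fun z => lam p * z) (esym (eta_xi_closed bp (df p u) gB))) _.
  apply: esym; apply: etrans (congr1 (pairing (df p u)) lin) _.
  exact: pairingZr.
have hs : hess p u (xi i p) = hess p (xi i p) u.
  by rewrite second_derivative.unlock; exact: (hess_sym oOm sF u (xi i p) Op).
have e := etrans (esym (pullback_eta_derive u (xi i p)))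
  (etrans (congr2 (fun y z => pairing y (sig b (f p)) + z) hs d2)
  (pullback_eta_derive (xi i p) u)).
have := addIr _ (etrans e (congr1 (fun z => _ + lam p * z) (eta_xi_closed ip u gA))).
move=> {e lin d2 hs} e; apply: etrans e.
by rewrite acm_eta_xi // mulr1.
Qed.

Lemma geodesic_derive (k : nat) (P : manifold R k.*2.+1) (C : acm_structure P)
    (j : chart P) (q : P) : geodesic_xi C -> cdom j q ->
  cderiv j (acm_xi C j) q (acm_xi C j q) =
  - Gamma (acm_g C) j q (acm_xi C j q) (acm_xi C j q).
Proof. by move=> geo jq; have /eqP := geo j q jq; rewrite /nabla addr_eq0 => /eqP. Qed.

Lemma sff_xi : geodesic_xi A -> geodesic_xi B ->
  sff p (xi i p) (xi i p) = conformal_rate p *: gam b (f p).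
Proof.
move=> gA gB.
have dxi := csmooth_derivable (v := xi i p) ip (acm_xi_csmooth A i setT) I.
have [_ el] := derive_df ip bp dxi.
have [dG eG] := derive_pullback ip bp (xi i p) (acm_xi_csmooth B b setT).
have dl := derivable_scalar (u := xi i p) conformal_factor_csmooth.
have [_ er] := is_derive_scalemx dl dG.
have lr : 'D_(xi i p) (fun y => 'D_((xi i \o cinv i) y) F y) (cmap i p) =
    'D_(xi i p) (fun y => (lam \o cinv i) y *: ((gam b \o cinv b) \o F) y) (cmap i p).
  apply: near_eq_derive; apply: (near_chart ip oU bp) => q iq Uq.
  by rewrite /= !cmapK //; exact: (df_xi iq Uq).
have Op' : Om' (cmap b (f p)) by exists (f p).
have lin : cderiv b (gam b) (f p) (lam p *: gam b (f p)) =
    lam p *: cderiv b (gam b) (f p) (gam b (f p)).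
  exact: (deriveZ_dir (lam p) (gam b (f p)) oOm' (acm_xi_csmooth B b setT 1%N) Op').
have := etrans (esym el) (etrans lr er).
rewrite eG /= (cmapK ip) (cmapK bp) => E.
have {}E : hess p (xi i p) (xi i p) + df p (cderiv i (xi i) p (xi i p)) =
    conformal_rate p *: gam b (f p) + lam p *: cderiv b (gam b) (f p) (df p (xi i p)).
  exact: E.
move: E => {el lr er dl dG eG dxi}.
rewrite (geodesic_derive gA ip) (dfN ip bp) (df_xi ip bp) lin (geodesic_derive gB bp).
rewrite /sff (df_xi ip bp) GammaZl (GammaZr (acm_g_metric B) bp) => {lin}.
move: (hess p _ _) (df p (Gamma _ _ _ _ _)) (Gamma h _ _ _ _) => x y z /eqP.
rewrite subr_eq => /eqP ->.
by apply/rowP => j; rewrite !mxE; ring.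
Qed.

End ConformalFactor.

Section Harmonicity.
Variables (p : M) (ip : cdom i p) (bp : cdom b (f p)).

Let Op : Om (cmap i p). Proof. by exists p. Qed.

(* By symmetry of the second derivatives of [lam], [d lam = mu eta] implies that
   [mu d eta] vanishes on [D]. *)
Lemma conformal_rate_eq0 : (0 < m)%N ->
  non_semi_phi_involutive A \/ non_phi_involutive A ->
  geodesic_xi A -> geodesic_xi B -> conformal_rate p = 0.
Proof.
move=> m0 noninv gA gB; have [u Du nz] := noninvolutive_at ip m0 noninv.
have Dv : in_D A i p (u *m phi i p) by rewrite /in_D acm_eta_phi.
have sl := conformal_factor_csmooth.
have second w z : in_D A i p w -> 'D_z ('D_w (lam \o cinv i)) (cmap i p) =
    conformal_rate p * pairing w (cderiv i (eta i) p z).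
  move=> Dw; have dr := derivable_scalar ip bp (u := z) conformal_rate_csmooth.
  have deta := csmooth_derivable (v := z) ip (acm_eta_csmooth A i setT) I.
  have [dp ep] := is_derive_pairing (derivable_cst w (cmap i p) z) deta.
  have e := deriveM dr dp.
  apply: etrans (etrans _ e) _.
    apply: near_eq_derive; apply: (near_chart ip oU bp) => q iq Uq.
    apply: etrans (conformal_factor_derive iq Uq w gA gB) _.
    by rewrite mulrfctE /= cmapK.
  rewrite ep derive_cst pairing0 add0r /= (cmapK ip).
  have -> : pairing w (eta i p) = 0 by exact: Dw.
  by rewrite scale0r addr0.
have comm : 'D_(u *m phi i p) ('D_u (lam \o cinv i)) (cmap i p) =
    'D_u ('D_(u *m phi i p) (lam \o cinv i)) (cmap i p).
  apply: derive_comm.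
  - have : nbhs (cmap i p) Om by exact: open_nbhs_nbhs.
    by apply: filterS => y Oy w; exact: (Ck_on_derivable (sl 1%N) Oy).
  - exact: (Ck_on_C1_at oOm (Ck_on_partial u (sl 2%N)) Op).
  - exact: (Ck_on_C1_at oOm (Ck_on_partial (u *m phi i p) (sl 2%N)) Op).
have := etrans (esym (second u (u *m phi i p) Du))
  (etrans comm (second (u *m phi i p) u Dv)) => {comm second} e.
apply/eqP; have : conformal_rate p * deta A i p u (u *m phi i p) == 0.
  by rewrite /deta mulrBr e subrr.
by rewrite mulf_eq0 (negPf nz) orbF.
Qed.

Lemma tension_eq0 : (0 < m)%N ->
  non_semi_phi_involutive A \/ non_phi_involutive A ->
  semi_symplectic A -> geodesic_xi A -> quasi_symplectic B -> geodesic_xi B ->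
  tension f g h i b p = 0.
Proof.
move=> m0 noninv ssA gA qsB gB.
have [V [e [oV Vp fe oe]]] := exists_phi_frame A ip.
pose L (X : 'M[R]_(m.*2.+1)) :=
  \sum_k \sum_l X k l *: sff p (delta_mx 0 k) (delta_mx 0 l).
have rank1 u : L (u^T *m u) = sff p u u.
  apply: bilinear_rank_one => [x y z|a x y|x y];
    [exact: (sffDl ip bp)|exact: (sffZl ip bp)|exact: (sff_sym ip bp)].
have LD X Y : L (X + Y) = L X + L Y.
  rewrite /L -big_split; apply: eq_bigr => k _; rewrite -big_split /=.
  by apply: eq_bigr => l _; rewrite mxE scalerDl.
have L0 : L 0 = 0.
  by rewrite /L big1 // => k _; rewrite big1 // => l _; rewrite mxE scale0r.
have -> : tension f g h i b p = L (invmx (g i p)).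
  by apply: eq_bigr => k _; apply: eq_bigr => l _; rewrite (sffE ip bp).
rewrite (invmx_metric_frame ip oe) LD (big_morph L LD L0) rank1.
rewrite (sff_xi ip bp gA gB) (conformal_rate_eq0 m0 noninv gA gB) scale0r add0r.
have De k : in_D A i p (e k i p) by exact: (oe k).1.
under eq_bigr do rewrite LD !rank1 (sff_D ip bp qsB (De _)).
have dfS : \sum_k df p (phi_covariant A i p (e k i p *m phi i p) (e k i p) -
      phi_covariant A i p (e k i p) (e k i p *m phi i p)) = df p 0.
  have df0 : df p 0 = 0 by rewrite -(scale0r 0) (dfZ ip bp) scale0r.
  rewrite -(big_morph (df p) (dfD ip bp) df0); congr (df p _).
  rewrite -[RHS](ssA V e oV fe i p Vp ip); apply: eq_bigr => k _; apply: esym.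
  have [/(_ k) [[se _] _] _] := fe.
  exact: (S_tensor_phi_vf A ip oV (se i) Vp).
by rewrite sumrN dfS -(scale0r 0) (dfZ ip bp) scale0r oppr0.
Qed.

End Harmonicity.

End HolomorphicMap.

Theorem theorem4p1 (R : realType) (m n : nat) (hm : (0 < m)%N)
    (M : manifold R m.*2.+1) (N : manifold R n.*2.+1)
    (A : acm_structure M) (B : acm_structure N) (f : M -> N)
    (f_smooth : smooth_map f)
    (f_holo : pm_holomorphic A B f)
    (M_noninv : non_semi_phi_involutive A \/ non_phi_involutive A)
    (M_semi : semi_symplectic A)
    (M_geod : geodesic_xi A)
    (N_quasi : quasi_symplectic B)
    (N_geod : geodesic_xi B) :
  harmonic_map f (acm_g A) (acm_g B).
Proof.
move=> i b p ip bp.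
have one : (1 : R) * 1 = 1 by rewrite mulr1.
have opp : (-1 : R) * (-1) = 1 by rewrite mulrNN mulr1.
case: f_holo => holo;
  [exact: (tension_eq0 f_smooth one holo)|exact: (tension_eq0 f_smooth opp holo)].
Qed.
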